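(* Let $(\mathrm{RRT}_n)_{n\ge0}$ be the sequence of random recursive trees, and let ${\sf Prof}_n=\frac1n\sum_k X_{n,k}\,\delta_k$, where $X_{n,k}$ is the number of nodes at distance $k$ from the root in $\mathrm{RRT}_n$. Then, almost surely as $n\to\infty$, $$\Theta_{\sqrt{\log n},\,\log n}\left({\sf Prof}_n\right)\longrightarrow\mathcal N(0,1)$$ for the topology of weak convergence of measures on $\mathbb R$.
   Context: The sequence of random recursive trees is a Markov chain: $\mathrm{RRT}_0$ consists of a single node (the root); $\mathrm{RRT}_{n+1}$ is obtained from $\mathrm{RRT}_n$ (which has $n+1$ nodes) by choosing a node uniformly at random in $\mathrm{RRT}_n$, independently of the past given $\mathrm{RRT}_n$, and adding a new child to it. For a measure $\mu$ on $\mathbb R$, $a\ne0$ and $b\in\mathbb R$, $\Theta_{a,b}(\mu)$ is the measure defined by $\int f\,d\Theta_{a,b}(\mu)=\int f(a^{-1}(x-b))\,d\mu(x)$ for all measurable $f$. Distance is graph distance. *)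

(* Defs.v *)
From HB Require Import structures.
From mathcomp Require Import all_boot all_order all_algebra.
From mathcomp Require Import all_classical all_reals all_analysis.
From mathcomp Require Import measurable_realfun.
Set Implicit Arguments.
Unset Strict Implicit.
Unset Printing Implicit Defensive.
Import Order.TTheory GRing.Theory Num.Theory.
Import numFieldNormedType.Exports.
Local Open Scope classical_set_scope.
Local Open Scope ring_scope.

(* [find] on [iota 0 #|T|] returns the least length k < #|T| of a walk from x
   to y, and #|T| when x and y are not connected. *)
Definition gdist (T : finType) (e : rel T) (x y : T) : nat :=
  find (fun k => [exists p : k.-tuple T, path e x p && (last x p == y)])
       (iota 0 #|T|).

(* A rooted tree whose nodes are numbered 0, 1, ..., m in their order of
   insertion, 0 being the root: it is encoded by the sequence of length m
   whose i-th entry is the parent of node i.+1. *)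
Definition parents_before (s : seq nat) : bool :=
  all (fun i => nth 0 s i <= i)%N (iota 0 (size s)).

Record rtree := RTree { parents :> seq nat; _ : parents_before parents }.
HB.instance Definition _ := [isSub for parents].
HB.instance Definition _ := [Countable of rtree by <:].

Notation tree_node t := 'I_(size (parents t)).+1.

Definition tree_root (t : rtree) : tree_node t := ord0.

Definition child_of (t : rtree) (u v : tree_node t) : bool :=
  (0 < v)%N && (nth 0%N t v.-1 == u).

Definition tree_adj (t : rtree) : rel (tree_node t) :=
  [rel u v | child_of u v || child_of v u].

Definition root_tree : rtree := @RTree [::] isT.

Lemma parents_before_rcons (t : rtree) (v : tree_node t) :
  parents_before (rcons t v).
Proof.
apply/allP => i; rewrite mem_iota add0n size_rcons leq0n ltnS /= => ile.
rewrite nth_rcons; case: ltnP => [ilt|ige].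
  by case: t v ile ilt => s /= /allP h v _ ilt; apply: h; rewrite mem_iota.
have -> : i = size t by apply/eqP; rewrite eqn_leq ile ige.
by rewrite eqxx -ltnS; apply: ltn_ord.
Qed.

Definition attach (t : rtree) (v : tree_node t) : rtree :=
  RTree (parents_before_rcons v).

Definition level_size (t : rtree) (k : nat) : nat :=
  #|[pred v : tree_node t | gdist (@tree_adj t) (tree_root t) v == k]|.

(* Transition rule given the whole past; the product form of the conditional
   probability also covers histories of probability 0. *)
Definition markov_chain d (Omega : measurableType d) (R : realType)
    (P : probability Omega R) (S : countType) (s0 : S) (p : S -> S -> R)
    (X : nat -> Omega -> S) : Prop :=
  [/\ forall n s, measurable (X n @^-1` [set s]),
      P (X 0%N @^-1` [set s0]) = 1%E &
      forall n (h : nat -> S) (s : S),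
        P ([set w | forall i, (i <= n)%N -> X i w = h i] `&`
           X n.+1 @^-1` [set s]) =
        (P [set w | forall i, (i <= n)%N -> X i w = h i] * (p (h n) s)%:E)%E].

(* Law of [attach v] for v uniform among the nodes of t. *)
Definition rrt_step (R : realType) (t t' : rtree) : R :=
  #|[pred v : tree_node t | attach v == t']|%:R / #|tree_node t|%:R.

Definition random_recursive_trees d (Omega : measurableType d) (R : realType)
    (P : probability Omega R) (T : nat -> Omega -> rtree) : Prop :=
  markov_chain P root_tree (@rrt_step R) T.

Definition theta_map (R : realType) (a b : R) (x : measurableTypeR R) :
  measurableTypeR R := a^-1 * (x - b).

Lemma measurable_theta_map (R : realType) (a b : R) :
  measurable_fun [set: measurableTypeR R] (theta_map a b).
Proof.
apply: continuous_measurable_fun => x.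
by apply: cvgM; [exact: cvg_cst|apply: cvgB; [exact: cvg_id|exact: cvg_cst]].
Qed.

Definition theta (R : realType) (a b : R)
    (mu : {measure set (measurableTypeR R) -> \bar R}) :
    set (measurableTypeR R) -> \bar R :=
  pushforward mu (theta_map a b).

Section theta_measure.
Variables (R : realType) (a b : R).
Variable mu : {measure set (measurableTypeR R) -> \bar R}.

Let mtheta_map := @measurable_theta_map R a b.

Let theta0 : theta a b mu set0 = 0%E.
Proof. exact: (@measure0 _ _ _ (pushforward mu (theta_map a b))). Qed.

Let theta_ge0 A : (0 <= theta a b mu A)%E.
Proof. exact: (@measure_ge0 _ _ _ (pushforward mu (theta_map a b))). Qed.

Let theta_sigma_additive : semi_sigma_additive (theta a b mu).
Proof.
exact: (@measure_semi_sigma_additive _ _ _ (pushforward mu (theta_map a b))).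
Qed.

HB.instance Definition _ := isMeasure.Build _ _ _ (theta a b mu)
  theta0 theta_ge0 theta_sigma_additive.

End theta_measure.

(* The factor is 1/n although the n-th tree has n.+1 nodes, so this is not a
   probability measure; for n = 0 it is the zero measure since 0^-1 = 0. *)
Definition prof (R : realType) (n : nat) (t : rtree) :
    {measure set (measurableTypeR R) -> \bar R} :=
  mscale (n%:R^-1)%:nng
    (mseries (fun k =>
       mscale (level_size t k)%:R%:nng \d_(k%:R : measurableTypeR R)) 0).

Definition weak_cvg (R : realType)
    (mu : nat -> {measure set (measurableTypeR R) -> \bar R})
    (nu : {measure set (measurableTypeR R) -> \bar R}) : Prop :=
  forall f : R -> R, continuous f -> bounded_fun f ->
    (\int[mu n]_x (f x)%:E)%E @[n --> \oo] --> (\int[nu]_x (f x)%:E)%E.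

(* Main.v *)
Require Import Defs.
From mathcomp Require Import all_boot all_order all_algebra.
From mathcomp Require Import all_classical all_reals all_analysis.
From mathcomp Require Import measurable_realfun.
From mathcomp Require Import complex.
From mathcomp Require Import zify ring lra.
Set Implicit Arguments.
Unset Strict Implicit.
Unset Printing Implicit Defensive.
Import Order.TTheory GRing.Theory Num.Theory.
Import numFieldNormedType.Exports.
Local Open Scope classical_set_scope.
Local Open Scope ring_scope.

(** Let [Z z t] be the sum of [z ^+ depth v] over the nodes [v] of a tree [t].
    Attaching a child to a uniform node of a tree with [n] edges multiplies the
    expectation of [Z z] by [1 + z / n.+1], so [Z z] divided by its expectation
    [mean_gf z] is a martingale of mean 1 ([gf_mart]).  If [z] is close to 1,
    its mean-square distance to 1 is at most [16 * |z - 1| ^ 2] uniformly in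
    time ([mean_gf_error_le]).

    The squared distance is a submartingale, and Doob's inequality
    ([submartingale_maximal]) bounds its supremum over all times.  For a
    sequence of parameters with [z k - 1 = O(1/k)] these bounds are summable, so
    by Borel-Cantelli the martingales of parameters [z k] tend to 1 uniformly in
    time, almost surely ([gf_error_as]).  Choosing [k] to be the integer part of
    the square root of [ln n] makes this usable at time [n]: as [k] is a
    function of [n], no union over the times, and no interpolation between
    them, is needed.

    With [z = exp (i * theta / k)] the characteristic function of the rescaled
    profile is thus asymptotic to its mean, which is explicit: the normalised
    [mean_gf] is the characteristic function of a sum of independent Bernoulli
    variables of parameters [1/2], ..., [1/(n+1)], hence nearly Gaussian, with
    mean and variance nearly [ln n] ([mean_gf_expi], [harm_ln],
    [charfun_near]).  With [z = exp (1/k)] and [z = exp (- 1/k)] one gets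
    exponential moments, hence bounded first absolute moments
    ([abs_moment_sqrt]).  They allow [k] to be replaced by the square root of
    [ln n] ([charfun_sqrt]), and they give tightness.

    Finally, convergence of the characteristic functions at rational frequencies
    and bounded first moments imply weak convergence ([weak_cvg_normal]).  A
    bounded continuous function is approximated on [[-K, K]] by a polynomial in
    [sin (x / K)], which is a trigonometric polynomial and stays bounded off
    that segment ([sin_poly_approx]); the limits of its terms are the
    Gaussian integrals of [normal_cos]. *)

(** * Depths in a recursive tree *)

Definition depths (s : seq nat) : seq nat :=
  foldl (fun ds p => rcons ds (nth 0%N ds p).+1) [:: 0%N] s.

Lemma depths_rcons s p :
  depths (rcons s p) = rcons (depths s) (nth 0%N (depths s) p).+1.
Proof. by rewrite /depths foldl_rcons. Qed.

Lemma size_depths s : size (depths s) = (size s).+1.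
Proof. by elim/last_ind: s => // s p IH; rewrite depths_rcons !size_rcons IH. Qed.

Lemma depths_root s : nth 0%N (depths s) 0 = 0%N.
Proof.
by elim/last_ind: s => // s p IH; rewrite depths_rcons nth_rcons size_depths.
Qed.

Lemma parents_before_rconsP s p :
  parents_before (rcons s p) = parents_before s && (p <= size s)%N.
Proof.
rewrite /parents_before size_rcons -addn1 iotaD all_cat /= andbT add0n.
rewrite nth_rcons ltnn eqxx; congr (_ && _).
apply: eq_in_all => i; rewrite mem_iota add0n /= => ilt.
by rewrite nth_rcons ilt.
Qed.

Lemma depths_parent s v : parents_before s -> (v < size s)%N ->
  nth 0%N (depths s) v.+1 = (nth 0%N (depths s) (nth 0%N s v)).+1.
Proof.
elim/last_ind: s => // s p IH; rewrite parents_before_rconsP => /andP[pb ps].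
rewrite size_rcons ltnS => vs.
rewrite depths_rcons !nth_rcons size_depths ltnS.
case: (ltnP v (size s)) => [vlt|vge].
  have pv : (nth 0 s v <= v)%N.
    by move/allP: pb => /(_ v); rewrite mem_iota; apply.
  by rewrite (leq_ltn_trans pv (leqW vlt)) IH.
have -> : v = size s by apply/eqP; rewrite eqn_leq vs.
by rewrite eqxx eqxx ltnS ps.
Qed.

Lemma depths_bound s v : (nth 0%N (depths s) v <= size s)%N.
Proof.
elim/last_ind: s v => [|s p IH] v; first by case: v => [|[|]].
rewrite depths_rcons nth_rcons size_rcons; case: ifP => _; first exact: leqW.
by case: ifP => _ //; rewrite ltnS.
Qed.

Definition depth (t : rtree) (v : tree_node t) : nat := nth 0%N (depths t) v.

Lemma depth_child (t : rtree) (u v : tree_node t) :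
  child_of u v -> depth v = (depth u).+1.
Proof.
rewrite /child_of /depth => /andP[v0 /eqP <-].
case: v v0 => -[//|v] /= vlt _; apply: depths_parent => //.
by case: (t).
Qed.

(** An edge changes the level by one, so a walk cannot reach a node in fewer
    steps than its depth; the chain of parents reaches it in exactly that many. *)
Lemma depth_path_le (t : rtree) (u : tree_node t) p :
  path (@tree_adj t) u p -> (depth (last u p) <= depth u + size p)%N.
Proof.
elim: p u => [|v p IH] u /=; first by rewrite addn0.
case/andP=> /orP[] /depth_child duv /IH /leq_trans; apply.
  by rewrite duv addSnnS.
by rewrite duv; lia.
Qed.

Lemma depth_path_ex (t : rtree) (v : tree_node t) :
  exists2 p, path (@tree_adj t) (tree_root t) p /\ last (tree_root t) p = v &
    size p = depth v.
Proof.
have [n] := ubnP (v : nat); elim: n v => // n IH v; rewrite ltnS => vn.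
have [v0|v0] := posnP (v : nat).
  exists [::] => /=; last first.
    by rewrite /depth v0 depths_root.
  by split=> //; apply: val_inj; rewrite /= v0.
have pb : parents_before t by case: (t).
have vt : (v.-1 < size t)%N by have := ltn_ord v; rewrite -ltnS prednK.
have pv : (nth 0 t v.-1 <= v.-1)%N.
  by move/allP: pb => /(_ v.-1); rewrite mem_iota; apply.
have ult : (nth 0 t v.-1 < (size t).+1)%N.
  by rewrite ltnS (leq_trans pv) // ltnW.
have cuv : child_of (Ordinal ult) v by rewrite /child_of v0 /=.
have [|p [pp lp] sp] := IH (Ordinal ult).
  by rewrite /= (leq_ltn_trans pv) // prednK.
exists (rcons p v); last by rewrite size_rcons sp (depth_child cuv).
by rewrite rcons_path last_rcons pp lp /tree_adj /= cuv.
Qed.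

Lemma gdist_root (t : rtree) (v : tree_node t) :
  gdist (@tree_adj t) (tree_root t) v = depth v.
Proof.
rewrite /gdist card_ord; set Q := (fun k => _).
have Qd : Q (depth v).
  have [p [pp lp] sp] := depth_path_ex v.
  apply/existsP; exists (tcast sp (in_tuple p)).
  by rewrite val_tcast /= pp lp eqxx.
have dlt : (depth v < (size t).+1)%N by rewrite ltnS depths_bound.
have hasQ : has Q (iota 0 (size t).+1).
  by apply/hasP; exists (depth v) => //; rewrite mem_iota.
apply/eqP; rewrite eqn_leq; apply/andP; split.
  rewrite leqNgt; apply/negP => /(before_find 0%N).
  by rewrite nth_iota // add0n Qd.
have flt : (find Q (iota 0 (size t).+1) < (size t).+1)%N.
  by move: hasQ; rewrite has_find size_iota.
move: (nth_find 0%N hasQ); rewrite nth_iota // add0n => /existsP[p].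
case/andP=> pp /eqP lp; rewrite -{1}lp.
have := depth_path_le pp.
by rewrite size_tuple {2}/depth depths_root.
Qed.

Lemma level_sizeE (t : rtree) k :
  level_size t k = count_mem k (depths t).
Proof.
rewrite /level_size -sum1_card -sum1_count (big_nth 0%N) size_depths big_mkord.
by apply: eq_bigl => v; rewrite inE gdist_root.
Qed.

Lemma sum_depth (V : nmodType) (t : rtree) (F : nat -> V) :
  \sum_(v : tree_node t) F (depth v) = \sum_(e <- depths t) F e.
Proof. by rewrite (big_nth 0%N) size_depths big_mkord. Qed.

Lemma sum_depths_attach (V : nmodType) (t : rtree) (v : tree_node t)
    (F : nat -> V) :
  \sum_(e <- depths (attach v)) F e = \sum_(e <- depths t) F e + F (depth v).+1.
Proof. by rewrite /= depths_rcons -cats1 big_cat big_seq1. Qed.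

(** * A maximal inequality for the chain of trees *)

(** The conditional expectation of [f] at the next tree given that the present
    one is [t]. *)
Definition child_mean (R : realType) (f : rtree -> R) (t : rtree) : R :=
  (\sum_(v : tree_node t) f (attach v)) / (size t).+1%:R.

Section chain.
Variables (R : realType) (d : measure_display) (Omega : measurableType d).
Variables (P : probability Omega R) (T : nat -> Omega -> rtree).
Hypothesis chainT : random_recursive_trees P T.

Let pr (A : set Omega) : R := fine (P A).

Let prE A : measurable A -> P A = (pr A)%:E.
Proof. by move=> mA; rewrite /pr fineK// fin_num_measure. Qed.

Let le_pr A B : measurable A -> measurable B -> A `<=` B -> pr A <= pr B.
Proof.
by move=> mA mB AB; rewrite -lee_fin -!prE// le_measure// inE.
Qed.

Let pr_ge0 A : 0 <= pr A.
Proof. by rewrite /pr fine_ge0. Qed.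

Definition history n (h : nat -> rtree) : set Omega :=
  [set w | forall i, (i <= n)%N -> T i w = h i].

Lemma measurable_chain_preimage n (A : set rtree) : measurable (T n @^-1` A).
Proof.
have [mT _ _] := chainT.
have -> : T n @^-1` A =
    \bigcup_t (if t \in A then T n @^-1` [set t] else set0).
  apply/seteqP; split=> w /=.
    by move=> Aw; exists (T n w) => //; rewrite mem_set.
  by move=> [t _]; case: ifPn => // /set_mem At; rewrite /preimage /= => ->.
apply: countable_bigcupT_measurable => // t; case: ifPn => // _; exact: mT.
Qed.

Lemma measurable_history n h : measurable (history n h).
Proof.
have [mT _ _] := chainT.
have -> : history n h = \bigcap_(i in `I_n.+1) (T i @^-1` [set h i]).
  by apply/seteqP; split=> w /= hw i; [move=> ?; apply: hw|move=> ?; apply: (hw i)].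
by apply: bigcap_measurableType => // i _; exact: mT.
Qed.

Lemma attach_inj (t : rtree) : injective (@attach t).
Proof.
move=> u v /(congr1 parents) /= /rcons_inj[] uv; exact: val_inj.
Qed.

Let reaches n h (v : tree_node (h n)) : set Omega :=
  history n h `&` T n.+1 @^-1` [set attach v].

Let m_reaches n h v : measurable (@reaches n h v).
Proof.
have [mT _ _] := chainT.
by apply: measurableI; [exact: measurable_history|exact: mT].
Qed.

Let pr_reaches n h v :
  pr (@reaches n h v) = pr (history n h) / (size (h n)).+1%:R.
Proof.
have [_ _ stepT] := chainT.
apply: EFin_inj; rewrite -prE // stepT prE; last exact: measurable_history.
rewrite -EFinM /rrt_step; congr ((_ * _)%:E).
rewrite card_ord; have -> : #|[pred u : tree_node (h n) | attach u == attach v]| = 1%N.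
  rewrite -(card1 v); apply: eq_card => u.
  by rewrite !inE (inj_eq (@attach_inj _)).
by rewrite mul1r.
Qed.

(** Conditionally on the past the next tree is almost surely one of the trees
    [attach v], because these already carry the whole transition mass. *)
Lemma history_step n h (B : set Omega) : measurable B ->
  pr (history n h `&` B) <= \sum_v pr (@reaches n h v `&` B).
Proof.
move=> mB; set A := history n h.
have mA : measurable A by exact: measurable_history.
pose U := \bigcup_v @reaches n h v.
have UE : U = \big[setU/set0]_v @reaches n h v.
  by rewrite -(bigcup_pred xpredT); apply: eq_bigcupl.
have UBE : U `&` B = \big[setU/set0]_v (@reaches n h v `&` B).
  by rewrite setI_bigcupl -(bigcup_pred xpredT); apply: eq_bigcupl.
have mU : measurable U.
  by rewrite UE; apply: bigsetU_measurable => v _; exact: m_reaches.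
have UA : U `<=` A by move=> w [v _ []].
have tri : trivIset setT (@reaches n h).
  move=> u v _ _ [w [[_ /= wu] [_ /= wv]]].
  by apply: (@attach_inj (h n)); rewrite -wu -wv.
have prU : pr U = pr A.
  rewrite UE; apply: EFin_inj; rewrite -prE; last by rewrite -UE.
  rewrite measure_bigsetU_ord // (eq_bigr (fun v => (pr (@reaches n h v))%:E)).
    rewrite sumEFin (eq_bigr _ (fun v _ => pr_reaches v)) sumr_const card_ord.
    by congr EFin; rewrite -[LHS]mulr_natr divfK // pnatr_eq0.
  by move=> v _; apply: prE.
have prUB : pr (U `&` B) = \sum_v pr (@reaches n h v `&` B).
  apply: EFin_inj; rewrite -prE; last exact: measurableI.
  rewrite UBE measure_bigsetU_ord => [|v|].
  - by rewrite -sumEFin; apply: eq_bigr => v _; apply: prE; apply: measurableI.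
  - exact: measurableI.
  - by move=> u v _ _ [w [[ru _] [rv _]]]; apply: tri => //; exists w.
have splitU C : measurable C -> pr C = pr (C `\` U) + pr (C `&` U).
  move=> mC; apply: EFin_inj; rewrite EFinD -!prE //.
  - exact: measureDI.
  - exact: measurableI.
  - exact: measurableD.
have prAU : pr (A `\` U) = 0.
  by have := splitU A mA; rewrite (setIidr UA) prU; lra.
have mAB : measurable (A `&` B) by exact: measurableI.
rewrite (splitU _ mAB).
have -> : A `&` B `&` U = U `&` B by rewrite setIC setIA (setIidl UA).
rewrite prUB gerDr -prAU le_pr //; first exact: measurableD.
- exact: measurableD.
- by move=> w [[]].
Qed.

Definition early_bad (V : rtree -> R) e n m : set Omega :=
  [set w | exists2 i, (n <= i <= n + m)%N &
           (size (T i w) != i) || (e <= V (T i w))].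

Lemma measurable_early_bad V e n m : measurable (early_bad V e n m).
Proof.
have -> : early_bad V e n m = \bigcup_(i in [set i | (n <= i <= n + m)%N])
    (T i @^-1` [set t : rtree | (size t != i) || (e <= V t)]).
  by apply/seteqP; split=> w [i /= hi hw]; exists i.
by apply: bigcup_measurable => i _; exact: measurable_chain_preimage.
Qed.

(** The maximal inequality for a nonnegative supermartingale [W] of the chain,
    started from an arbitrary history.  Trees of the wrong size count as bad
    because a fair step cannot produce them. *)
Lemma supermartingale_maximal (W : rtree -> R) (N : nat) (e : R) :
  0 < e -> (forall t, 0 <= W t) ->
  (forall t : rtree, (size t < N)%N -> child_mean W t <= W t) ->
  forall m n (h : nat -> rtree), (n + m = N)%N -> size (h n) = n ->
  e * pr (history n h `&` early_bad W e n m) <= pr (history n h) * W (h n).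
Proof.
move=> e0 W0 Wsuper.
have already_bad n h B : measurable B -> e <= W (h n) ->
    e * pr (history n h `&` B) <= pr (history n h) * W (h n).
  move=> mB We; rewrite mulrC; apply: ler_pM => //; first exact: ltW.
  apply: le_pr => //.
  - by apply: measurableI => //; exact: measurable_history.
  - exact: measurable_history.
elim=> [|m IH] n h nmN hn; have mB := measurable_early_bad W e n;
  (have [We|We] := leP e (W (h n)); first exact: already_bad).
  rewrite (_ : _ `&` _ = set0); first by rewrite {1}/pr measure0 mulr0 mulr_ge0 ?pr_ge0.
  apply/seteqP; split=> w //= [hw [j]]; rewrite addn0 -eqn_leq => /eqP <-.
  by rewrite hw // hn eqxx /= leNgt We.
have mA : measurable (history n h) by exact: measurable_history.
have mBn := measurable_early_bad W e n.+1.
have Nn : (n < N)%N by rewrite -nmN addnS ltnS leq_addr.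
pose hv v i := if (i <= n)%N then h i else @attach (h n) v.
have historyv v : history n.+1 (hv v) = @reaches n h v.
  apply/seteqP; split=> w /=.
    move=> hw; split=> /= [i ile|]; last by rewrite hw // /hv ltnn.
    by rewrite hw ?leqW // /hv ile.
  by move=> [hw /= nw] i; rewrite leq_eqVlt /hv ltnS => /orP[/eqP ->|ile];
    rewrite ?ltnn // ile hw.
have lastv v : hv v n.+1 = attach v by rewrite /hv ltnn.
apply: (@le_trans _ _ (\sum_v e * pr (@reaches n h v `&` early_bad W e n.+1 m))).
  rewrite -mulr_sumr ler_pM2l //.
  apply: (le_trans _ (@history_step n h _ (mBn m))) => //.
  apply: le_pr; [exact: measurableI| exact: measurableI|].
  move=> w [hw [j]] /andP[ni im] bad; split=> //.
  exists j => //; rewrite addSnnS im andbT ltn_neqAle ni andbT.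
  apply/eqP => in_; move: bad; rewrite -in_ hw // hn eqxx /= leNgt We //.
apply: (@le_trans _ _ (\sum_v pr (history n h) / n.+1%:R * W (attach v))).
  apply: ler_sum => v _.
  have -> : pr (history n h) / n.+1%:R = pr (@reaches n h v).
    by rewrite pr_reaches hn.
  rewrite -historyv -lastv.
  by apply: IH; rewrite ?addSnnS // lastv /= size_rcons hn.
rewrite -mulr_sumr -mulrA ler_wpM2l // mulrC.
have szn : n.+1%:R = (size (h n)).+1%:R :> R by rewrite hn.
by rewrite szn; apply: Wsuper; rewrite hn.
Qed.

Lemma ler_child_mean (f g : rtree -> R) t :
  (forall v : tree_node t, f (attach v) <= g (attach v)) ->
  child_mean f t <= child_mean g t.
Proof. by move=> fg; rewrite ler_pM2r ?invr_gt0 // ler_sum. Qed.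

(** Doob's inequality for a nonnegative submartingale [V]: its conditional
    expectation at a horizon [N] is a supermartingale that dominates [V] up to
    that horizon. *)
Lemma submartingale_maximal (V : rtree -> R) (K e : R) :
  0 < e -> (forall t, 0 <= V t) -> (forall t, V t <= child_mean V t) ->
  (forall N, iter N (@child_mean R) V root_tree <= K) ->
  (P [set w | exists i, (size (T i w) != i) || (e <= V (T i w))%R] <=
    (K / e)%:E)%E.
Proof.
move=> e0 V0 Vsub VK.
have [mT P0 _] := chainT.
have iter0 m t : 0 <= iter m (@child_mean R) V t.
  elim: m t => [|m IH] t /=; first exact: V0.
  by rewrite /child_mean divr_ge0 // sumr_ge0.
have iterV m t : V t <= iter m (@child_mean R) V t.
  elim: m t => [|m IH] t //=; apply: (le_trans (Vsub t)).
  exact: ler_child_mean.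
pose h0 (i : nat) := root_tree.
pose W N t := iter (N - size (parents t)) (@child_mean R) V t.
have bound N : pr (early_bad V e 0 N) <= K / e.
  have Wsuper t : (size (parents t) < N)%N -> child_mean (W N) t <= W N t.
    move=> tN; rewrite /W -[(N - size t)%N]prednK ?subn_gt0 //=.
    apply: ler_child_mean => v; rewrite /= size_rcons.
    by rewrite -subn1 -subnDA addn1.
  have W0 t : 0 <= W N t by exact: iter0.
  have := @supermartingale_maximal (W N) N e e0 W0 Wsuper N 0 h0 (add0n N) erefl.
  set A := history 0 h0; set B := early_bad V e 0 N => maxW.
  have mB : measurable B by exact: measurable_early_bad.
  have mA : measurable A by exact: measurable_history.
  have mBW := measurable_early_bad (W N) e 0 N.
  have PA : pr A = 1.
    rewrite /pr (_ : A = T 0 @^-1` [set root_tree]) ?P0 //.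
    apply/seteqP; split=> w /=; first exact.
    by move=> wr i; rewrite leqn0 => /eqP ->.
  have BW : B `<=` early_bad (W N) e 0 N.
    move=> w [i iN bad]; exists i => //; case/orP: bad => [-> //|eV].
    by rewrite (le_trans eV) ?orbT // iterV.
  have PAB : pr B <= pr (A `&` early_bad (W N) e 0 N).
    rewrite -lee_fin -!prE //; last exact: measurableI.
    have PC : P (~` A) = 0%E by rewrite probability_setC // prE // PA subee.
    set C := A `&` _; have mC : measurable C by exact: measurableI.
    have mAC : measurable (~` A) by exact: measurableC.
    apply: (@le_trans _ _ (P (C `|` ~` A))); last by rewrite measureU0.
    apply: le_measure; rewrite ?inE //; first exact: measurableU.
    move=> w /BW Bw; have [Aw|] := pselect (A w); first by left.
    by right.
  rewrite ler_pdivlMr // mulrC (le_trans (ler_wpM2l (ltW e0) PAB)) //.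
  by rewrite (le_trans maxW) // PA mul1r /W subn0 VK.
have -> : [set w | exists i, (size (T i w) != i) || (e <= V (T i w))] =
    \bigcup_N early_bad V e 0 N.
  apply/seteqP; split=> w /=.
    by move=> [i iw]; exists i => //; exists i; rewrite ?add0n ?leqnn.
  by move=> [N _ [i _ iw]]; exists i.
have mb N : measurable (early_bad V e 0 N) by exact: measurable_early_bad.
have ndb : nondecreasing_seq (early_bad V e 0).
  move=> a b ab; apply/subsetPset => w [i ia iw]; exists i => //.
  by rewrite add0n (leq_trans ia).
have cvb := nondecreasing_cvg_mu (mu := P) mb (bigcupT_measurable _ mb) ndb.
rewrite -(cvg_lim _ cvb) //; apply: lime_le; first by apply: cvgP cvb.
by apply: nearW => N /=; rewrite prE // lee_fin.
Qed.

End chain.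

(** * The generating function of the depths *)

Section generating_function.
Variable F : numFieldType.
Implicit Types (z : F) (t : rtree).

Definition depth_gf z t : F := \sum_(e <- depths t) z ^+ e.

(** The expectation of [depth_gf z] after [n] steps: each step multiplies it by
    [1 + z / i.+1]. *)
Definition mean_gf z n : F := \prod_(i < n) (1 + z / i.+1%:R).

Definition gf_mart z t : F := depth_gf z t / mean_gf z (size t).

Lemma depth_gf_attach z t (v : tree_node t) :
  depth_gf z (attach v) = depth_gf z t + z * z ^+ depth v.
Proof. by rewrite /depth_gf sum_depths_attach exprS. Qed.

Lemma mean_gfS z n : mean_gf z n.+1 = mean_gf z n * (1 + z / n.+1%:R).
Proof. by rewrite /mean_gf big_ord_recr. Qed.

(** The increment is written with the centred variable [z ^+ depth v], so that
    both the martingale property and the variance of one step can be read off. *)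
Lemma gf_mart_attach z t (v : tree_node t) : mean_gf z (size t).+1 != 0 ->
  gf_mart z (attach v) = gf_mart z t + z / mean_gf z (size t).+1 *
    (z ^+ depth v - depth_gf z t / (size t).+1%:R).
Proof.
move=> a0; rewrite /gf_mart depth_gf_attach /= size_rcons.
move: a0; rewrite mean_gfS mulf_eq0 negb_or => /andP[a0 c0].
have N0 : (size t).+1%:R != 0 :> F by rewrite pnatr_eq0.
move: (size t).+1%:R N0 c0 => N N0 c0.
have Nz : N + z != 0.
  by apply: contraNneq c0 => Nz; rewrite -[X in X + _](divff N0) -mulrDl Nz mul0r.
by field; rewrite N0 Nz a0.
Qed.

Lemma sum_gf_mart z t : mean_gf z (size t).+1 != 0 ->
  \sum_(v : tree_node t) gf_mart z (attach v) = (size t).+1%:R * gf_mart z t.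
Proof.
move=> a0; under eq_bigr do rewrite gf_mart_attach //.
rewrite big_split /= sumr_const card_ord -mulr_sumr big_split /= sumr_const.
rewrite card_ord (sum_depth t (fun e => z ^+ e)) -/(depth_gf z t).
rewrite -[gf_mart z t *+ _]mulr_natl -[(- _) *+ _]mulr_natr mulNr divfK.
  by rewrite subrr mulr0 addr0.
by rewrite pnatr_eq0.
Qed.

Lemma gf_mart_root z : gf_mart z root_tree = 1.
Proof. by rewrite /gf_mart /depth_gf /mean_gf /= big_seq1 big_ord0 divr1. Qed.

End generating_function.

Section complex_sums.
Variable R : realType.
Implicit Types x y c : R[i].

Definition sqnorm x : R := complex.Re x ^+ 2 + complex.Im x ^+ 2.

Lemma sqnorm_ge0 x : 0 <= sqnorm x.
Proof. by rewrite addr_ge0 ?sqr_ge0. Qed.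

Lemma sqnormM x y : sqnorm (x * y) = sqnorm x * sqnorm y.
Proof. by case: x y => [a b] [c e]; rewrite /sqnorm /=; ring. Qed.

Lemma sqnorm1 : sqnorm 1 = 1.
Proof. by rewrite /sqnorm /= expr1n expr0n addr0. Qed.

Lemma sqnormX x n : sqnorm (x ^+ n) = sqnorm x ^+ n.
Proof. by elim: n => [|n IH]; rewrite ?sqnorm1 // !exprS sqnormM IH. Qed.

Lemma sqnorm_eq0 x : (sqnorm x == 0) = (x == 0).
Proof.
by rewrite paddr_eq0 ?sqr_ge0 // !sqrf_eq0; case: x => a b; rewrite eq_complex.
Qed.

Lemma sqnormV x : sqnorm x^-1 = (sqnorm x)^-1.
Proof.
have [->|x0] := eqVneq x 0; first by rewrite invr0 /sqnorm /= expr0n addr0 invr0.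
apply: (mulfI (_ : sqnorm x != 0)); first by rewrite sqnorm_eq0.
by rewrite -sqnormM !divff ?sqnorm1 // sqnorm_eq0.
Qed.

Lemma Re_sum (I : Type) (r : seq I) (f : I -> R[i]) :
  complex.Re (\sum_(i <- r) f i) = \sum_(i <- r) complex.Re (f i).
Proof. by apply: (big_morph (@complex.Re R)) => // -[a b] [c e]. Qed.

Lemma Im_sum (I : Type) (r : seq I) (f : I -> R[i]) :
  complex.Im (\sum_(i <- r) f i) = \sum_(i <- r) complex.Im (f i).
Proof. by apply: (big_morph (@complex.Im R)) => // -[a b] [c e]. Qed.

(** The parallel-axis identity: fluctuations around the mean do not
    correlate with a constant. *)
Lemma sum_sqnorm_centered n (x c : R[i]) (u : 'I_n.+1 -> R[i]) :
  \sum_i sqnorm (x + c * (u i - (\sum_j u j) / n.+1%:R)) =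
  n.+1%:R * sqnorm x +
  sqnorm c * (\sum_i sqnorm (u i) - sqnorm (\sum_j u j) / n.+1%:R).
Proof.
set m := (\sum_j u j) / _.
have N0 : n.+1%:R != 0 :> R[i] by rewrite pnatr_eq0.
have N0r : n.+1%:R != 0 :> R by rewrite pnatr_eq0.
have um : \sum_j u j = n.+1%:R * m by rewrite mulrC divfK.
pose l (y : R[i]) := 2 * (complex.Re (c * y) * complex.Re x + complex.Im (c * y) * complex.Im x).
pose k (y : R[i]) := 2 * (complex.Re y * complex.Re m + complex.Im y * complex.Im m).
have eqi i : sqnorm (x + c * (u i - m)) = sqnorm x + sqnorm c * sqnorm (u i) +
    sqnorm c * sqnorm m + l (u i) - l m - sqnorm c * k (u i).
  by rewrite /sqnorm /l /k; case: (x) (c) (u i) (m) => [a b] [c1 c2] [e f] [g h] /=; ring.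
have split_sum (a b e : R) (f g h : 'I_n.+1 -> R) :
    \sum_i (a + f i + b + g i - e - h i) =
    n.+1%:R * (a + b - e) + \sum_i f i + \sum_i g i - \sum_i h i.
  have cst (y : R) : \sum_(i < n.+1) y = n.+1%:R * y.
    by rewrite sumr_const card_ord mulr_natl.
  by rewrite !big_split !sumrN !cst /=; ring.
rewrite (eq_bigr _ (fun i _ => eqi i)) split_sum.
have sl : \sum_i l (u i) = n.+1%:R * l m.
  rewrite /l -mulr_sumr big_split /= -!mulr_suml -Re_sum -Im_sum -mulr_sumr um.
  have -> : n.+1%:R = (n.+1%:R : R)%:C%C by rewrite rmorph_nat.
  by move: (n.+1%:R : R) => N; case: (c) (m) (x) => [a b] [e f] [g h] /=; ring.
have sk : \sum_i sqnorm c * k (u i) = sqnorm c * (2 * n.+1%:R * sqnorm m).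
  rewrite -mulr_sumr /k; congr (_ * _); rewrite -mulr_sumr big_split /= -!mulr_suml -Re_sum -Im_sum um.
  have -> : n.+1%:R = (n.+1%:R : R)%:C%C by rewrite rmorph_nat.
  by move: (n.+1%:R : R) => N; rewrite /sqnorm; case: (m) => [a b] /=; ring.
rewrite sl sk -[\sum_i sqnorm c * _]mulr_sumr um sqnormM.
have -> : sqnorm n.+1%:R = n.+1%:R ^+ 2.
  have -> : n.+1%:R = (n.+1%:R : R)%:C%C by rewrite rmorph_nat.
  by rewrite /sqnorm /= expr0n addr0.
move: (n.+1%:R : R) N0r (l m) (\sum_i sqnorm (u i)) => N N0' lm su.
by move: (sqnorm m) (sqnorm x) (sqnorm c) => sm sx sc; field.
Qed.

End complex_sums.

(** * Elementary inequalities *)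

Lemma sum_inv_sq_le (R : realType) n :
  \sum_(0 <= k < n) (k.+1%:R ^- 2 : R) <= 2 - (if n is 0 then 2 else n%:R^-1).
Proof.
case: n => [|n]; first by rewrite big_geq // subrr.
elim: n => [|n IH]; first by rewrite big_nat1 expr1n invr1; lra.
rewrite big_nat_recr //=; apply: (le_trans (lerD IH (lexx _))).
have N0 : 0 < n.+1%:R :> R by [].
rewrite (_ : n.+2%:R = n.+1%:R + 1 :> R); last by rewrite natr1.
move: (n.+1%:R : R) N0 => N N0; rewrite -subr_ge0.
have N1 : 0 < N + 1 by rewrite ltr_wpDr.
have -> : 2 - (N + 1)^-1 - (2 - N^-1 + (N + 1) ^- 2) = (N * (N + 1) ^+ 2)^-1.
  by field; rewrite !gt_eqF.
by rewrite invr_ge0 mulr_ge0 ?exprn_ge0 ?ltW.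
Qed.

Section elementary_bounds.
Variable R : realType.

(** Each trigonometric Taylor bound below comes from the previous one in this
    way. *)
Lemma ge0_of_derive (F f : R -> R) :
  (forall x : R, is_derive x 1 F (f x)) -> (forall x, 0 <= x -> 0 <= f x) ->
  F 0 = 0 -> forall x, 0 <= x -> 0 <= F x.
Proof.
move=> dF f0 F0 x x0.
have cF : {within `[0, x], continuous F}.
  apply: continuous_subspaceT => y; apply: differentiable_continuous.
  by apply/derivable1_diffP; have [] := dF y.
have [c] := MVT_segment x0 (fun y _ => dF y) cF.
by rewrite in_itv /= F0 !subr0 => /andP[c0 _] ->; rewrite mulr_ge0 ?f0.
Qed.

Lemma sin_le_id (x : R) : 0 <= x -> sin x <= x.
Proof.
move=> x0; rewrite -subr_ge0; move: x x0.
apply: (@ge0_of_derive (fun x => x - sin x) (fun x => 1 - cos x)).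
- by move=> x _; rewrite subr_ge0 cos_le1.
- by rewrite sin0 subrr.
Qed.

Lemma cos_ge_quadratic (x : R) : 1 - x ^+ 2 / 2 <= cos x.
Proof.
wlog x0 : x / 0 <= x.
  by move=> h; have [|/ltW x0] := leP 0 x; [exact: h|rewrite -cosN -sqrrN; apply: h; rewrite oppr_ge0].
rewrite -subr_ge0; move: x x0.
apply: (@ge0_of_derive (fun x => cos x - (1 - x ^+ 2 / 2)) (fun x => x - sin x)).
- by move=> x; apply: is_derive_eq; rewrite /GRing.scale /=; lra.
- by move=> x x0; rewrite subr_ge0 sin_le_id.
- by rewrite cos0 expr0n /=; lra.
Qed.

Lemma sin_ge_cubic (x : R) : 0 <= x -> x - x ^+ 3 / 6 <= sin x.
Proof.
move=> x0; rewrite -subr_ge0; move: x x0.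
apply: (@ge0_of_derive (fun x => sin x - (x - x ^+ 3 / 6)) (fun x => cos x - (1 - x ^+ 2 / 2))).
- by move=> x; apply: is_derive_eq; rewrite /GRing.scale /=; lra.
- by move=> x x0; rewrite subr_ge0 cos_ge_quadratic.
- by rewrite sin0 expr0n /=; lra.
Qed.

Lemma cos_le_quartic (x : R) : cos x <= 1 - x ^+ 2 / 2 + x ^+ 4 / 24.
Proof.
wlog x0 : x / 0 <= x.
  move=> h; have [|/ltW x0] := leP 0 x; first exact: h.
  have E2 : (- x) ^+ 2 = x ^+ 2 by ring.
  have E4 : (- x) ^+ 4 = x ^+ 4 by ring.
  by have := h (- x); rewrite cosN E2 E4; apply; rewrite oppr_ge0.
rewrite -subr_ge0; move: x x0.
apply: (@ge0_of_derive (fun x => 1 - x ^+ 2 / 2 + x ^+ 4 / 24 - cos x) (fun x => sin x - (x - x ^+ 3 / 6))).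
- by move=> x; apply: is_derive_eq; rewrite /GRing.scale /=; lra.
- by move=> x x0; rewrite subr_ge0 sin_ge_cubic.
- by rewrite cos0 !expr0n /=; lra.
Qed.

Lemma sin_cubic (x : R) : `|sin x - x| <= `|x| ^+ 3 / 6.
Proof.
wlog x0 : x / 0 <= x.
  move=> h; have [|/ltW x0] := leP 0 x; first exact: h.
  have := h (- x); rewrite sinN normrN -opprD normrN; apply.
  by rewrite oppr_ge0.
rewrite (ger0_norm x0) ler_norml; apply/andP; split.
  by have := sin_ge_cubic x0; lra.
have := sin_le_id x0; have : 0 <= x ^+ 3 by rewrite exprn_ge0.
lra.
Qed.

Lemma cos_quartic (x : R) : `|cos x - 1 + x ^+ 2 / 2| <= x ^+ 4 / 24.
Proof.
have h1 := cos_ge_quadratic x; have h2 := cos_le_quartic x.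
by rewrite ger0_norm; lra.
Qed.

Lemma expRN_bounds (v : R) : 0 <= v ->
  [/\ expR (- v) <= 1, 1 - v <= expR (- v) & expR (- v) <= 1 - v + v ^+ 2].
Proof.
move=> v0; split; first by rewrite expR_le1 oppr_le0.
  exact: expR_ge1Dx.
have h := expR_ge1Dx v; have h1 : 0 < 1 + v by lra.
rewrite expRN; apply: (@le_trans _ _ (1 + v)^-1).
  by rewrite lef_pV2 ?posrE ?expR_gt0.
rewrite -subr_ge0 (_ : _ - _ = v ^+ 3 / (1 + v)); last by field; rewrite gt_eqF.
by rewrite divr_ge0 ?exprn_ge0 // ltW.
Qed.

Lemma expR_quadratic (v : R) : v <= 1 / 2 -> expR v <= 1 + v + 2 * v ^+ 2.
Proof.
move=> v1; have h := expR_ge1Dx (- v); rewrite expRN in h.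
have h1 : 0 < 1 - v by lra.
apply: (@le_trans _ _ (1 - v)^-1).
  by rewrite -[leLHS]invrK lef_pV2 ?posrE ?invr_gt0 ?expR_gt0.
rewrite -subr_ge0 (_ : _ - _ = v ^+ 2 * (1 - 2 * v) / (1 - v)); last by field; rewrite gt_eqF.
apply: divr_ge0; last exact: ltW.
by apply: mulr_ge0; [exact: sqr_ge0|lra].
Qed.

(** The first term of the harmonic sum is left out because it corresponds to the
    factor [n.+1] of [mean_gf], which normalises the profile. *)
Definition harm n : R := \sum_(i < n) i.+2%:R^-1.

Lemma harm_ln n : (0 < n)%N -> `|harm n - ln n%:R| <= 1.
Proof.
move=> n0.
have up m : harm m <= ln m.+1%:R.
  elim: m => [|m IH]; first by rewrite /harm big_ord0 ln1.
  rewrite /harm big_ord_recr /= -/(harm m).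
  have m1 : 0 < m.+1%:R :> R by []. have m2 : 0 < m.+2%:R :> R by [].
  have h : ln (1 + - m.+2%:R^-1) <= - m.+2%:R^-1 :> R.
    by apply: le_ln1Dx; rewrite ltrN2 invf_lt1 // ltr1n.
  have E : 1 + - m.+2%:R^-1 = m.+1%:R / m.+2%:R :> R.
    rewrite (_ : m.+2%:R = m.+1%:R + 1); last by rewrite natr1.
    by move: (m.+1%:R : R) m1 => N N0; field; rewrite gt_eqF // ltr_wpDr.
  move: h IH; rewrite E ln_div ?posrE //.
  by move: (harm m) (ln m.+1%:R) (ln m.+2%:R) (m.+2%:R^-1) => a b c e; lra.
have lo m : ln m.+1%:R <= harm m + 1 - m.+1%:R^-1.
  elim: m => [|m IH]; first by rewrite /harm big_ord0 ln1 invr1; lra.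
  rewrite /harm big_ord_recr /= -/(harm m).
  have m1 : 0 < m.+1%:R :> R by []. have m2 : 0 < m.+2%:R :> R by [].
  have h : ln (1 + m.+1%:R^-1) <= m.+1%:R^-1 :> R.
    by apply: le_ln1Dx; rewrite (lt_trans _ (_ : 0 < _)) ?invr_gt0 //; lra.
  have E : 1 + m.+1%:R^-1 = m.+2%:R / m.+1%:R :> R.
    rewrite (_ : m.+2%:R = m.+1%:R + 1); last by rewrite natr1.
    by move: (m.+1%:R : R) m1 => N N0; field; rewrite gt_eqF.
  move: h IH; rewrite E ln_div ?posrE //.
  move: (harm m) (ln m.+1%:R) (ln m.+2%:R) (m.+2%:R^-1) (m.+1%:R^-1) => a b c e f.
  by lra.
case: n n0 => // n _.
have lnS : ln n.+2%:R <= ln n.+1%:R + 1 :> R.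
  rewrite -lerBlDl -ln_div ?posrE //.
  have -> : n.+2%:R / n.+1%:R = 1 + n.+1%:R^-1 :> R.
    rewrite (_ : n.+2%:R = n.+1%:R + 1); last by rewrite natr1.
    have : 0 < n.+1%:R :> R by [].
    by move: (n.+1%:R : R) => N N0; field; rewrite gt_eqF.
  apply: (le_trans (le_ln1Dx _)).
    by apply: (@lt_trans _ _ 0); rewrite ?ltrN10 ?invr_gt0.
  by rewrite invf_le1 // ler1n.
have h1 := up n.+1; have h2 := lo n.+1.
have h3 : ln n.+1%:R <= ln n.+2%:R :> R by rewrite ler_ln ?posrE // ler_nat.
have h4 : 0 <= n.+2%:R^-1 :> R by rewrite invr_ge0.
move: h1 h2 h3 h4 lnS; rewrite ler_norml.
move: (harm n.+1) (ln n.+1%:R) (ln n.+2%:R) (n.+2%:R^-1) => a b c e *.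
by apply/andP; split; lra.
Qed.

End elementary_bounds.

(** * The mean generating function on the unit circle *)

Section complex_estimates.
Variable R : realType.
Implicit Types x y : R[i].
Local Notation normc := (@Normc.normc R).

Definition expi (u : R) : R[i] := (cos u +i* sin u)%C.

Lemma expiD u v : expi (u + v) = expi u * expi v.
Proof.
by apply/eqP; rewrite eq_complex /= cosD sinD eqxx /= addrC eqxx.
Qed.

Lemma expi0 : expi 0 = 1.
Proof. by rewrite /expi cos0 sin0. Qed.

Lemma expiMn u n : expi (u * n%:R) = expi u ^+ n.
Proof.
elim: n => [|n IH]; first by rewrite mulr0 expi0.
by rewrite -natr1 mulrDr mulr1 expiD IH exprSr.
Qed.

Lemma normc_sqr x : normc x ^+ 2 = sqnorm x.
Proof. by case: x => a b; rewrite /= sqr_sqrtr // addr_ge0 ?sqr_ge0. Qed.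

Lemma normc_ge0 x : 0 <= normc x.
Proof. by case: x => a b; rewrite sqrtr_ge0. Qed.

Lemma normc_add x y : normc (x + y) <= normc x + normc y.
Proof. exact: le_normcD. Qed.

Lemma normc_opp x : normc (- x) = normc x.
Proof. exact: normcN. Qed.

Lemma normc_mul x y : normc (x * y) = normc x * normc y.
Proof. exact: Normc.normcM. Qed.

Lemma normc_real (u : R) : normc u%:C%C = `|u|.
Proof. by rewrite /= expr0n addr0 sqrtr_sqr. Qed.

Lemma normc_expi u : normc (expi u) = 1.
Proof. by rewrite /= cos2Dsin2 sqrtr1. Qed.

Lemma normc_Re x : `|complex.Re x| <= normc x.
Proof.
rewrite -ler_sqr ?nnegrE ?normc_ge0 // normc_sqr real_normK ?num_real //.
by rewrite lerDl sqr_ge0.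
Qed.

Lemma normc_Im x : `|complex.Im x| <= normc x.
Proof.
rewrite -ler_sqr ?nnegrE ?normc_ge0 // normc_sqr real_normK ?num_real //.
by rewrite lerDr sqr_ge0.
Qed.

Lemma normc_ReIm x : normc x <= `|complex.Re x| + `|complex.Im x|.
Proof.
rewrite -ler_sqr ?nnegrE ?normc_ge0 ?addr_ge0 // normc_sqr sqrrD.
rewrite !real_normK ?num_real // /sqnorm addrAC lerDl.
by rewrite mulrn_wge0 // mulr_ge0.
Qed.

Lemma normc_sum (I : Type) (r : seq I) (f : I -> R[i]) :
  normc (\sum_(i <- r) f i) <= \sum_(i <- r) normc (f i).
Proof.
elim: r => [|i r IH]; first by rewrite !big_nil Normc.normc0.
by rewrite !big_cons (le_trans (normc_add _ _)) // lerD2l.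
Qed.

Lemma normc_expi_sub u v : normc (expi u - expi v) <= `|u - v|.
Proof.
have -> : expi u - expi v = expi v * (expi (u - v) - 1).
  by rewrite mulrBr mulr1 -expiD; congr (expi _ - _); ring.
rewrite normc_mul normc_expi mul1r; move: (u - v) => w.
rewrite -ler_sqr ?nnegrE ?normc_ge0 // normc_sqr /sqnorm /= subr0.
rewrite real_normK ?num_real //.
have h1 := cos_ge_quadratic w; have h2 := cos2Dsin2 w; nra.
Qed.

Lemma normc_prod_le1 n (f : 'I_n -> R[i]) :
  (forall i, normc (f i) <= 1) -> normc (\prod_i f i) <= 1.
Proof.
elim: n f => [|n IH] f h; first by rewrite big_ord0 Normc.normc1.
rewrite big_ord_recr normc_mul /= mulr_ile1 ?normc_ge0 // IH // => i.
Qed.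

Lemma normc_prod_sub n (f g : nat -> R[i]) :
  (forall i, normc (f i) <= 1) -> (forall i, normc (g i) <= 1) ->
  normc (\prod_(i < n) f i - \prod_(i < n) g i) <= \sum_(i < n) normc (f i - g i).
Proof.
move=> f1 g1; elim: n => [|n IH].
  by rewrite !big_ord0 subrr Normc.normc0.
rewrite !big_ord_recr /=.
have -> : \prod_(i < n) f i * f n - \prod_(i < n) g i * g n =
  (\prod_(i < n) f i - \prod_(i < n) g i) * f n +
  (\prod_(i < n) g i) * (f n - g n) by ring.
apply: (le_trans (normc_add _ _)); rewrite !normc_mul lerD //.
  by apply: le_trans IH; rewrite ler_piMr ?normc_ge0.
by rewrite ler_piMl ?normc_ge0 ?normc_prod_le1.
Qed.

(** Both factors are [1 + (i u - u ^ 2 / 2) * g] up to the stated error. *)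
Lemma normc_factor_sub (u g : R) : `|u| <= 1 -> 0 <= g <= 1 ->
  normc (1 + (expi u - 1) * g%:C%C -
         (expR (- (u ^+ 2 / 2 * g)))%:C%C * expi (u * g)) <=
  2 * `|u| ^+ 3 * g + 2 * u ^+ 2 * g ^+ 2.
Proof.
move=> u1 /andP[g0 g1].
have hc := cos_quartic u; have hs := sin_cubic u.
have hcg1 := cos_ge_quadratic (u * g); have hcg2 := cos_le1 (u * g).
have hsg := sin_cubic (u * g).
have v0 : 0 <= u ^+ 2 / 2 * g by rewrite mulr_ge0 // divr_ge0 ?sqr_ge0.
have [p1 p2 p3] := expRN_bounds v0.
have p0 := expR_ge0 (- (u ^+ 2 / 2 * g)).
have sg : `|sin (u * g)| <= `|u| * g.
  have := normc_expi_sub (u * g) 0; rewrite subr0 normrM (ger0_norm g0).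
  apply: le_trans; apply: le_trans (normc_Im _).
  by rewrite /= sin0 subr0.
have a0 := normr_ge0 u.
have u2 : u ^+ 2 = `|u| ^+ 2 by rewrite real_normK ?num_real.
have u4 : u ^+ 4 = `|u| ^+ 4 by rewrite (exprM u 2 2) u2 -exprM.
apply: (le_trans (normc_ReIm _)) => /=.
rewrite !mul0r !mulr0 !subr0 !addr0 !add0r.
move: hcg1 hcg2 hsg hc hs sg v0 p1 p2 p3 p0.
rewrite normrM (ger0_norm g0) !exprMn u2 u4.
move: (cos u) (sin u) (cos (u * g)) (sin (u * g)) (expR _) => cu su cg sn p.
move: u1 a0; move: `|u| => a a1 a0 hcg1 hcg2 hsg hc hs sg v0 p1 p2 p3 p0.
have a3 : 0 <= a ^+ 3 by rewrite exprn_ge0.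
have a43 : a ^+ 4 <= a ^+ 3 by rewrite exprS ler_piMl.
have a32 : a ^+ 3 <= a ^+ 2 by rewrite exprS ler_piMl ?sqr_ge0.
have g2 : 0 <= g ^+ 2 by exact: sqr_ge0.
have b1 : a ^+ 4 * g <= a ^+ 3 * g by rewrite ler_wpM2r.
have b2 : a ^+ 4 * g ^+ 2 <= a ^+ 2 * g ^+ 2 by rewrite ler_wpM2r // (le_trans a43).
have b3 : a ^+ 3 * g ^+ 3 <= a ^+ 3 * g.
  by rewrite ler_wpM2l // exprSr ler_piMl // exprn_ile1.
have b4 : a ^+ 3 * g ^+ 2 <= a ^+ 2 * g ^+ 2 by rewrite ler_wpM2r.
have b5 : 0 <= a ^+ 3 * g by rewrite mulr_ge0.
have b6 : 0 <= a ^+ 2 * g ^+ 2 by rewrite mulr_ge0 ?sqr_ge0.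
have re : `|1 + (cu - 1) * g - p * cg| <= a ^+ 3 * g / 24 + 3 / 4 * (a ^+ 2 * g ^+ 2).
  have -> : 1 + (cu - 1) * g - p * cg =
    (cu - 1 + a ^+ 2 / 2) * g + (1 - a ^+ 2 / 2 * g - p) + p * (1 - cg) by ring.
  apply: (le_trans (ler_normD _ _)).
  apply: (le_trans (lerD (ler_normD _ _) (lexx _))).
  have r1 : `|(cu - 1 + a ^+ 2 / 2) * g| <= a ^+ 4 * g / 24.
    by rewrite normrM (ger0_norm g0) [leRHS]mulrAC ler_wpM2r.
  have r2 : `|1 - a ^+ 2 / 2 * g - p| <= a ^+ 4 * g ^+ 2 / 4.
    have -> : a ^+ 4 * g ^+ 2 / 4 = a ^+ 2 * a ^+ 2 * 2^-1 ^+ 2 * g ^+ 2 by field.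
    by rewrite ler_norml; apply/andP; split; lra.
  have r3 : `|p * (1 - cg)| <= a ^+ 2 * g ^+ 2 / 2.
    rewrite ger0_norm ?mulr_ge0 ?subr_ge0 //.
    by apply: (@le_trans _ _ (1 - cg)); [rewrite ler_piMl ?subr_ge0|lra].
  by lra.
have im : `|su * g - p * sn| <= a ^+ 3 * g / 3 + a ^+ 2 * g ^+ 2 / 2.
  have -> : su * g - p * sn = (su - u) * g - (sn - u * g) + (1 - p) * sn by ring.
  apply: (le_trans (ler_normD _ _)).
  apply: (le_trans (lerD (ler_normB _ _) (lexx _))).
  have r1 : `|(su - u) * g| <= a ^+ 3 * g / 6.
    by rewrite normrM (ger0_norm g0) [leRHS]mulrAC ler_wpM2r.
  have r3 : `|(1 - p) * sn| <= a ^+ 3 * g ^+ 2 / 2.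
    rewrite normrM ger0_norm ?subr_ge0 //.
    have -> : a ^+ 3 * g ^+ 2 / 2 = (a ^+ 2 / 2 * g) * (a * g) by field.
    by apply: ler_pM; rewrite ?subr_ge0 //; lra.
  by lra.
by lra.
Qed.

(** Up to [n.+1], the mean is the generating function of a sum of independent
    Bernoulli variables of parameters [1/2], ..., [1/(n+1)]. *)
Let mean_gfE (z : R[i]) n : mean_gf z n =
  n.+1%:R * \prod_(i < n) (1 + (z - 1) * (i.+2%:R^-1 : R)%:C%C).
Proof.
elim: n => [|n IH]; first by rewrite /mean_gf !big_ord0 mul1r.
rewrite mean_gfS IH big_ord_recr /=.
have -> : (n.+2%:R^-1 : R)%:C%C = n.+2%:R^-1 :> R[i].
  by rewrite fmorphV rmorph_nat.
have N1 : n.+1%:R != 0 :> R[i] by rewrite pnatr_eq0.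
have N2 : n.+1%:R + 1 != 0 :> R[i] by rewrite natr1 pnatr_eq0.
rewrite -[n.+2%:R]natr1; move: (n.+1%:R : R[i]) N1 N2 => N N1 N2.
by field; rewrite N1 N2.
Qed.

Let normc_factor_le1 (u : R) i :
  normc (1 + (expi u - 1) * (i.+2%:R^-1 : R)%:C%C) <= 1.
Proof.
have /andP[h0 h1] : 0 <= (i.+2%:R^-1 : R) <= 1 by rewrite invr_ge0 invf_le1 // ler0n ler1n.
have -> : 1 + (expi u - 1) * (i.+2%:R^-1 : R)%:C%C =
    (1 - i.+2%:R^-1)%:C%C + expi u * (i.+2%:R^-1 : R)%:C%C.
  by rewrite rmorphB /=; ring.
apply: (le_trans (normc_add _ _)); rewrite normc_mul normc_expi !normc_real mul1r.
by rewrite !ger0_norm ?subr_ge0 // subrK.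
Qed.

Lemma normc_mean_gf_expi u n : normc (mean_gf (expi u) n / n.+1%:R) <= 1.
Proof.
rewrite mean_gfE mulrC mulKf ?pnatr_eq0 //.
by apply: normc_prod_le1 => i; exact: normc_factor_le1.
Qed.

(** Lindeberg's replacement: the characteristic functions of the Bernoulli
    variables are exchanged one by one for those of Gaussian variables with mean
    and variance [i.+2%:R^-1].  The error [u ^ 2] comes from their true variance
    being smaller by a summable amount. *)
Lemma mean_gf_expi (u : R) n : `|u| <= 1 ->
  normc (mean_gf (expi u) n / n.+1%:R -
    (expR (- (u ^+ 2 / 2 * harm R n)))%:C%C * expi (u * harm R n)) <=
  2 * `|u| ^+ 3 * harm R n + 4 * u ^+ 2.
Proof.
move=> u1.
have N1 : n.+1%:R != 0 :> R[i] by rewrite pnatr_eq0.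
rewrite mean_gfE mulrC mulKf //.
pose x (i : nat) := 1 + (expi u - 1) * (i.+2%:R^-1 : R)%:C%C.
pose y (i : nat) := (expR (- (u ^+ 2 / 2 * i.+2%:R^-1)))%:C%C * expi (u * i.+2%:R^-1).
have -> : (expR (- (u ^+ 2 / 2 * harm R n)))%:C%C * expi (u * harm R n) =
    \prod_(i < n) y i.
  elim: n {N1} => [|n IH].
    by rewrite /harm !big_ord0 !mulr0 oppr0 expR0 expi0 mulr1.
  rewrite big_ord_recr /= -IH /y /harm big_ord_recr /= -/(harm R n).
  rewrite !mulrDr opprD expRD expiD rmorphM /=; ring.
have g01 i : 0 <= (i.+2%:R^-1 : R) <= 1 by rewrite invr_ge0 invf_le1 // ler0n ler1n.
have x1 i : normc (x i) <= 1 by exact: normc_factor_le1.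
have y1 i : normc (y i) <= 1.
  rewrite /y normc_mul normc_expi normc_real mulr1 ger0_norm ?expR_ge0 //.
  by rewrite expR_le1 oppr_le0 mulr_ge0 ?divr_ge0 ?sqr_ge0.
apply: (le_trans (normc_prod_sub n x1 y1)).
apply: (@le_trans _ _ (\sum_(i < n) (2 * `|u| ^+ 3 * i.+2%:R^-1 + 2 * u ^+ 2 * i.+2%:R^-1 ^+ 2))).
  by apply: ler_sum => i _; apply: normc_factor_sub.
rewrite big_split /= -!mulr_sumr lerD2l.
have : \sum_(i < n) (i.+2%:R^-1 : R) ^+ 2 <= 2.
  apply: (@le_trans _ _ (\sum_(0 <= k < n) (k.+1%:R ^- 2 : R))).
    rewrite big_mkord; apply: ler_sum => i _.
    by rewrite exprVn lef_pV2 ?posrE ?exprn_gt0 // lerXn2r ?nnegrE // ler_nat.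
  apply: (le_trans (sum_inv_sq_le R n)); rewrite gerBl.
  by case: (n) => // m; rewrite invr_ge0.
have := sqr_ge0 u; nra.
Qed.

End complex_estimates.

(** * Second moments of the normalised generating function *)

Section iterated_mean.
Variable R : realType.
Implicit Types (f g h : rtree -> R) (t : rtree).

Lemma iter_child_mean_le n f g t :
  (forall t', size (parents t') = (size t + n)%N -> f t' <= g t') ->
  iter n (@child_mean R) f t <= iter n (@child_mean R) g t.
Proof.
elim: n t => [|n IH] t fg /=; first by apply: fg; rewrite addn0.
apply: ler_child_mean => v; apply: IH => t' /= st'; apply: fg.
by rewrite st' size_rcons addSnnS.
Qed.

Lemma iter_child_mean_affine n f g h (a b c : R) t :
  iter n (@child_mean R) (fun s => f s + a * g s + b * h s + c) t =
  iter n (@child_mean R) f t + a * iter n (@child_mean R) g t +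
  b * iter n (@child_mean R) h t + c.
Proof.
elim: n t => [|n IH] t //=; rewrite /child_mean.
rewrite (eq_bigr _ (fun v _ => IH (attach v))) !big_split /= -!mulr_sumr.
rewrite sumr_const card_ord -[c *+ _]mulr_natl.
have : (size t).+1%:R != 0 :> R by rewrite pnatr_eq0.
by move: ((size t).+1%:R : R) => N N0; field.
Qed.

Lemma iter_child_mean_id n f t : (forall s, child_mean f s = f s) ->
  iter n (@child_mean R) f t = f t.
Proof. by move=> fE; elim: n t => //= n IH t; rewrite -[RHS]fE; congr (child_mean _ _); apply/funext. Qed.

End iterated_mean.

Section second_moment.
Variables (R : realType) (z : R[i]).
Hypothesis z1 : sqnorm (z - 1) <= 1 / 4.

Let p : R := complex.Re z.
Let q : R := complex.Im z.
Let eps := sqnorm (z - 1).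
Let x := sqnorm z.

Definition gf_error (t : rtree) : R := sqnorm (gf_mart z t - 1).

Let epsE : eps = (p - 1) ^+ 2 + q ^+ 2.
Proof. by rewrite /eps /p /q /sqnorm; case: (z) => a b /=; rewrite subr0. Qed.

Let p_near : `|p - 1| <= 1 / 2.
Proof.
move: z1; rewrite -/eps epsE => h.
have q0 := sqr_ge0 q; rewrite ler_norml; apply/andP; split; nra.
Qed.

Let x_le : x <= 9 / 4.
Proof.
move: z1 p_near; rewrite -/eps epsE /x /sqnorm -/p -/q => h /ler_normlP[h1 h2].
rewrite (_ : p ^+ 2 + q ^+ 2 = (p - 1) ^+ 2 + q ^+ 2 + 2 * p - 1); last by ring.
by lra.
Qed.

Let x_ge0 : 0 <= x. Proof. exact: sqnorm_ge0. Qed.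

Let sqnorm_shift n : sqnorm (n.+1%:R + z) = (n.+1%:R + p) ^+ 2 + q ^+ 2.
Proof.
have -> : n.+1%:R = (n.+1%:R : R)%:C%C by rewrite rmorph_nat.
by rewrite /sqnorm /p /q; case: (z) => a b /=; rewrite add0r.
Qed.

Let shift_ge n : (9 / 16) * n.+2%:R ^+ 2 <= sqnorm (n.+1%:R + z).
Proof.
rewrite sqnorm_shift; have := p_near => /ler_normlP[p1 p2].
have : 1 <= n.+1%:R :> R by rewrite ler1n.
rewrite (_ : n.+2%:R = n.+1%:R + 1); last by rewrite natr1.
move: (n.+1%:R : R) => N N1.
have h : 3 / 4 * (N + 1) <= N + p by lra.
have q0 := sqr_ge0 q.
by rewrite (_ : 9 / 16 = (3 / 4) ^+ 2 :> R) -?exprMn; [nra|field].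
Qed.

Let shift_gt0 n : 0 < sqnorm (n.+1%:R + z).
Proof. by apply: lt_le_trans (shift_ge n); rewrite mulr_gt0 ?exprn_gt0 //; lra. Qed.

Let factor_sqnorm n : sqnorm (1 + z / n.+1%:R) = sqnorm (n.+1%:R + z) / n.+1%:R ^+ 2.
Proof.
have N0 : n.+1%:R != 0 :> R[i] by rewrite pnatr_eq0.
have -> : 1 + z / n.+1%:R = (n.+1%:R + z) / n.+1%:R by rewrite mulrDl divff.
rewrite sqnormM sqnormV; congr (_ / _).
have -> : n.+1%:R = (n.+1%:R : R)%:C%C by rewrite rmorph_nat.
by rewrite /sqnorm /= expr0n addr0.
Qed.

Lemma mean_gf_neq0 n : mean_gf z n != 0.
Proof.
elim: n => [|n IH]; first by rewrite /mean_gf big_ord0 oner_neq0.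
by rewrite mean_gfS mulf_neq0 // -sqnorm_eq0 factor_sqnorm mulf_neq0 ?gt_eqF //.
Qed.

Let mean_gf_x n : 0 < mean_gf x n.
Proof.
rewrite /mean_gf; apply: prodr_gt0 => i _.
by rewrite addrC ltr_wpDl // divr_ge0.
Qed.

(** The centred increment adds its variance, since it is uncorrelated with the
    present value. *)
Lemma child_mean_gf_error t :
  child_mean gf_error t = gf_error t +
    x / sqnorm (mean_gf z (size t).+1) *
    (depth_gf x t / (size t).+1%:R - sqnorm (depth_gf z t) / (size t).+1%:R ^+ 2).
Proof.
have N0 : (size t).+1%:R != 0 :> R by rewrite pnatr_eq0.
rewrite /child_mean /gf_error.
have E (v : tree_node t) : gf_mart z (attach v) - 1 = (gf_mart z t - 1) +
    z / mean_gf z (size t).+1 *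
    (z ^+ depth v - (\sum_(u : tree_node t) z ^+ depth u) / (size t).+1%:R).
  rewrite gf_mart_attach ?mean_gf_neq0 // (sum_depth t (fun e => z ^+ e)).
  by rewrite addrAC.
under eq_bigr do rewrite E.
rewrite sum_sqnorm_centered (sum_depth t (fun e => z ^+ e)) -/(depth_gf z t).
rewrite (eq_bigr _ (fun v _ => sqnormX z (depth v))).
rewrite (sum_depth t (fun e => x ^+ e)) -/(depth_gf x t).
rewrite sqnormM sqnormV -/x.
move: ((sqnorm (mean_gf z (size t).+1))^-1).
move: N0; move: ((size t).+1%:R : R) => N N0 ia.
move: (sqnorm (depth_gf z t)) (depth_gf x t) (sqnorm _) => a b c.
by field.
Qed.

(** Both [mean_gf x] and [sqnorm (mean_gf z)] grow like powers of the time; in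
    this ratio the powers cancel up to an exponent of order [eps]. *)
Let u n : R := mean_gf x n * n.+1%:R / sqnorm (mean_gf z n) - 1.

Let u0 : u 0 = 0.
Proof. by rewrite /u /mean_gf !big_ord0 sqnorm1 !mul1r invr1 subrr. Qed.

Let uS n : u n.+1 + 1 = (u n + 1) *
  (1 + eps * n.+1%:R / sqnorm (n.+1%:R + z)).
Proof.
rewrite /u !subrK !mean_gfS sqnormM factor_sqnorm.
have S0 := shift_gt0 n; rewrite sqnorm_shift in S0 *.
have a0 : sqnorm (mean_gf z n) != 0 by rewrite sqnorm_eq0 mean_gf_neq0.
have N0 : 0 < n.+1%:R :> R by [].
rewrite (_ : n.+2%:R = n.+1%:R + 1 :> R); last by rewrite natr1.
move: (n.+1%:R : R) (mean_gf x n) (sqnorm (mean_gf z n)) S0 a0 N0 => N A B S0 a0 N0.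
by rewrite /x /sqnorm -/p -/q epsE; field; rewrite a0 !gt_eqF.
Qed.

Let u_ge0 n : 0 <= u n.
Proof.
elim: n => [|n IH]; first by rewrite u0.
rewrite -(lerD2r 1) add0r uS mulr_ege1 //; first by rewrite lerDr.
by rewrite lerDl divr_ge0 ?mulr_ge0 ?sqnorm_ge0.
Qed.

Let u_le n : u n.+1 <= u n + (1 + u n) * (2 * eps / n.+2%:R).
Proof.
have step : eps * n.+1%:R / sqnorm (n.+1%:R + z) <= 2 * eps / n.+2%:R.
  rewrite ler_pdivrMr ?shift_gt0 //.
  apply: le_trans (ler_wpM2l _ (shift_ge n)); last first.
    by rewrite divr_ge0 ?mulr_ge0 ?sqnorm_ge0.
  have ab : n.+1%:R <= n.+2%:R :> R by rewrite ler_nat.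
  have b0 : 0 < n.+2%:R :> R by [].
  have e0 : 0 <= eps by exact: sqnorm_ge0.
  move: (n.+1%:R : R) (n.+2%:R : R) ab b0 => a b ab b0.
  rewrite (_ : 2 * eps / b * _ = 9 / 8 * eps * b); last by field; rewrite gt_eqF.
  by nra.
rewrite -(lerD2r 1) uS; have un := u_ge0 n.
by move: (_ / _) (_ / _) (u n) step un => r s v; nra.
Qed.

Let Re_mart t : child_mean (fun t => complex.Re (gf_mart z t)) t =
  complex.Re (gf_mart z t).
Proof.
have N0 : (size t).+1%:R != 0 :> R by rewrite pnatr_eq0.
rewrite /child_mean -Re_sum sum_gf_mart ?mean_gf_neq0 //.
have -> : (size t).+1%:R = ((size t).+1%:R : R)%:C%C by rewrite rmorph_nat.
by case: (gf_mart z t) => a b /=; rewrite mul0r subr0 mulrC mulKf.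
Qed.

Let x_mart t : child_mean (gf_mart x) t = gf_mart x t.
Proof.
rewrite /child_mean sum_gf_mart ?gt_eqF //.
by rewrite mulrC mulKf // pnatr_eq0.
Qed.

Let k n := x / sqnorm (n.+1%:R + z).

Let k_ge0 n : 0 <= k n.
Proof. by rewrite divr_ge0 ?sqnorm_ge0. Qed.

Let k_le n : k n <= 4 / n.+2%:R ^+ 2.
Proof.
rewrite /k ler_pdivrMr ?shift_gt0 // (le_trans x_le) //.
apply: le_trans (ler_wpM2l _ (shift_ge n)); last by rewrite divr_ge0 // sqr_ge0.
have : n.+2%:R != 0 :> R by rewrite pnatr_eq0.
by move: (n.+2%:R : R) => a a0; rewrite le_eqVlt (_ : 4 / _ * _ = 9 / 4) ?eqxx //; field.
Qed.

(** In the variance of a step, the square of the mean is bounded below by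
    [2 * Re M - 1] for the martingale [M]; this is affine in [M], whose mean is
    one, so the recursion closes without any information on second moments. *)
Let mean_gf_error_step n :
  iter n.+1 (@child_mean R) gf_error root_tree <=
  iter n (@child_mean R) gf_error root_tree + k n * u n.
Proof.
rewrite iterSr.
pose b := sqnorm (mean_gf z n).
have b0 : b != 0 by rewrite sqnorm_eq0 mean_gf_neq0.
have b_gt0 : 0 < b by rewrite lt_neqAle eq_sym b0 sqnorm_ge0.
pose c1 := k n * mean_gf x n * n.+1%:R / b.
apply: (@le_trans _ _ (iter n (@child_mean R) (fun t => gf_error t +
    c1 * gf_mart x t + - (2 * k n) * complex.Re (gf_mart z t) + k n) root_tree)).
  apply: iter_child_mean_le => t st; rewrite child_mean_gf_error -!addrA lerD2l.
  rewrite {}add0n in st.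
  have Gx : depth_gf x t = mean_gf x n * gf_mart x t.
    by rewrite /gf_mart st mulrC divfK // gt_eqF.
  have Gz : sqnorm (depth_gf z t) = b * sqnorm (gf_mart z t).
    by rewrite -sqnormM /gf_mart st mulrC divfK // mean_gf_neq0.
  have Mge : 2 * complex.Re (gf_mart z t) - 1 <= sqnorm (gf_mart z t).
    rewrite /sqnorm; move: (complex.Re _) (complex.Im _) => m1 m2.
    by have := sqr_ge0 m2; have := sqr_ge0 (m1 - 1); nra.
  have N0 : n.+1%:R != 0 :> R by rewrite pnatr_eq0.
  rewrite Gx Gz st mean_gfS sqnormM factor_sqnorm -/b /c1.
  have -> : x / (b * (sqnorm (n.+1%:R + z) / n.+1%:R ^+ 2)) =
      k n * n.+1%:R ^+ 2 / b.
    have S0 : sqnorm (n.+1%:R + z) != 0 by rewrite gt_eqF.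
    rewrite /k; move: (sqnorm _) S0 => S S0.
    by move: (n.+1%:R : R) N0 => N N0; field; rewrite N0 S0 b0.
  have kn := k_ge0 n.
  move: (sqnorm (gf_mart z t)) (complex.Re _) (gf_mart x t) (mean_gf x n) Mge.
  move: (n.+1%:R : R) (k n) N0 kn => N kn N0 kn0 sM rM gx A Mge.
  rewrite (_ : _ * _ = kn * A * N / b * gx - kn * sM); last by field; rewrite N0 b0.
  by nra.
rewrite iter_child_mean_affine (iter_child_mean_id _ _ x_mart).
rewrite (iter_child_mean_id _ _ Re_mart) !gf_mart_root /c1 /u -/b.
by rewrite /= le_eqVlt; apply/orP; left; apply/eqP; field.
Qed.

(** Of the decrease of [u n / n.+1], one half pays for the increase of the error,
    whence the factor 8, and the other half for the growth of [u], whose rate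
    [2 * eps] is at most [1/2].  What remains telescopes. *)
Let gf_error_potential n :
  iter n (@child_mean R) gf_error root_tree / 8 + u n / n.+1%:R <=
  2 * eps * (1 - n.+1%:R^-1).
Proof.
elim: n => [|n IH].
  by rewrite u0 invr1 subrr mulr0 mul0r addr0 /= /gf_error gf_mart_root subrr
    /sqnorm /= expr0n addr0 mul0r.
have h1 := mean_gf_error_step n; have h2 := k_le n; have h3 := u_le n.
have h4 := u_ge0 n; have e0 : 0 <= eps by exact: sqnorm_ge0.
have e1 : eps <= 1 / 4 by [].
have N0 : 0 < n.+1%:R :> R by [].
move: h2 h3 IH; rewrite (_ : n.+2%:R = n.+1%:R + 1 :> R); last by rewrite natr1.
move: (n.+1%:R : R) N0 (iter n.+1 _ _ _) (iter n _ _ _) (u n.+1) (u n) (k n) h1 h4.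
move=> N N0 E' E u' v kn h1 h4 h2 h3 IH.
have J0 : 0 < N + 1 by rewrite ltr_wpDr.
have h5 : E' <= E + 4 / (N + 1) ^+ 2 * v by apply: (le_trans h1); rewrite lerD2l ler_wpM2r.
have h6 : u' / (N + 1) <= (v + (1 + v) * (2 * eps / (N + 1))) / (N + 1).
  by rewrite ler_pM2r ?invr_gt0.
have h7 : E' / 8 + u' / (N + 1) <= 2 * eps * (1 - N^-1) - v / N +
   v / (N + 1) ^+ 2 / 2 + (v + (1 + v) * (2 * eps / (N + 1))) / (N + 1).
  have : E' / 8 <= E / 8 + v / (N + 1) ^+ 2 / 2.
    rewrite (_ : E / 8 + _ = (E + 4 / (N + 1) ^+ 2 * v) / 8) ?ler_pM2r //.
    by field; rewrite gt_eqF.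
  by lra.
apply: (le_trans h7); rewrite -subr_ge0.
rewrite (_ : _ - _ = (v * (N + 2 - 4 * eps * N) / 2 + 2 * eps) / (N * (N + 1) ^+ 2)).
  apply: divr_ge0; last by rewrite mulr_ge0 ?exprn_ge0 // ltW.
  have : 0 <= v * (N * (1 - 4 * eps)).
    by apply: mulr_ge0 => //; apply: mulr_ge0; [exact: ltW|lra].
  by rewrite !mulrBr; lra.
by field; rewrite !gt_eqF.
Qed.

(** The bound does not depend on the time, so that Doob's inequality controls the
    whole evolution of the tree for one [z] at once; and it is quadratic in
    [z - 1], so that it is summable along parameters at distance [1/k] from [1]. *)
Lemma mean_gf_error_le n :
  iter n (@child_mean R) gf_error root_tree <= 16 * sqnorm (z - 1).
Proof.
have := gf_error_potential n; have := u_ge0 n; have := sqnorm_ge0 (z - 1).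
rewrite -/eps => e0 h1 h2.
have h3 : 0 <= u n / n.+1%:R by rewrite divr_ge0.
have h4 : 0 <= eps * n.+1%:R^-1 by rewrite mulr_ge0 ?invr_ge0.
rewrite mulrBr mulr1 -mulrA in h2.
by move: (iter n _ _ _) (u n / _) (eps * _) h2 h3 h4 => E v w h2 h3 h4; lra.
Qed.

Lemma gf_error_le_child_mean t : gf_error t <= child_mean gf_error t.
Proof.
rewrite child_mean_gf_error lerDl mulr_ge0 ?divr_ge0 ?sqnorm_ge0 //.
have := @sum_sqnorm_centered _ (size t) 0 1 (fun v => z ^+ @depth t v).
rewrite sqnorm1 mul1r (_ : sqnorm 0 = 0); last by rewrite /sqnorm /= expr0n addr0.
rewrite mulr0 add0r => E.
have : 0 <= \sum_(v : tree_node t) sqnorm (z ^+ depth v) -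
    sqnorm (\sum_(v : tree_node t) z ^+ depth v) / (size t).+1%:R.
  by rewrite -E sumr_ge0 // => v _; apply: sqnorm_ge0.
rewrite (eq_bigr _ (fun v _ => sqnormX z (depth v))).
rewrite (sum_depth t (fun e => x ^+ e)) (sum_depth t (fun e => z ^+ e)).
rewrite -/(depth_gf x t) -/(depth_gf z t) => h.
by rewrite expr2 invfM mulrA -mulrBl divr_ge0.
Qed.

Lemma gf_error_ge0 t : 0 <= gf_error t.
Proof. exact: sqnorm_ge0. Qed.

End second_moment.

(** * Almost sure convergence *)

Section almost_sure.
Variables (R : realType) (d : measure_display) (Omega : measurableType d).
Variables (P : probability Omega R) (T : nat -> Omega -> rtree).
Hypothesis chainT : random_recursive_trees P T.

Let bad (V : rtree -> R) (e : R) : set Omega :=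
  [set w | exists i, (size (T i w) != i) || (e <= V (T i w))].

Let measurable_bad V e : measurable (bad V e).
Proof.
have -> : bad V e =
    \bigcup_i (T i @^-1` [set t : rtree | (size t != i) || (e <= V t)]).
  by apply/seteqP; split=> w /=; [move=> [i iw]; exists i|move=> [i _ iw]; exists i].
by apply: bigcupT_measurable => i; exact: (measurable_chain_preimage chainT).
Qed.

(** Trees of the wrong size count as bad in the maximal inequality, which is
    therefore informative even for the zero function. *)
Lemma size_tree_as : {ae P, forall w, forall n, size (T n w) = n}.
Proof.
have mean0 t : child_mean (fun=> 0 : R) t = 0.
  by rewrite /child_mean big1 // mul0r.
have iter0 N t : iter N (@child_mean R) (fun=> 0) t = 0.
  by rewrite iter_child_mean_id // => s; rewrite mean0.
have := @submartingale_maximal _ _ _ P T chainT (fun=> 0) 0 1 ltr01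
  (fun _ => lexx _) (fun t => _) (fun N => _).
rewrite mul0r => h; exists (bad (fun=> 0) 1); split.
- exact: measurable_bad.
- apply/eqP; rewrite eq_le measure_ge0 andbT; apply: h.
    by move=> t; rewrite mean0.
  by move=> N; rewrite iter0.
- by move=> w /= /existsNP[j /eqP jw]; exists j; rewrite jw.
Qed.

(** Each parameter has a single bad event covering all times, of probability
    [O(1/k^2)], so the lemma of Borel and Cantelli applies along the parameters
    and never along the times. *)
Lemma gf_error_as (z : nat -> R[i]) (C : R) :
  (forall k, sqnorm (z k - 1) <= C / k.+1%:R ^+ 2) ->
  {ae P, forall w, forall e, 0 < e ->
    \forall k \near \oo, forall n, gf_error (z k) (T n w) < e}.
Proof.
move=> zC.
have C0 : 0 <= C by have := zC 0; rewrite expr1n divr1; apply: le_trans; exact: sqnorm_ge0.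
have [K KC] : exists K : nat, 4 * C <= K%:R.
  by exists (Num.truncn (4 * C)).+1; rewrite ltW // truncnS_gt.
have zK k : (K <= k)%N -> sqnorm (z k - 1) <= 1 / 4.
  move=> Kk; apply: le_trans (zC k) _.
  have k1 : 1 <= k.+1%:R :> R by rewrite ler1n.
  have k2 : 4 * C <= k.+1%:R by apply: le_trans KC _; rewrite ler_nat leqW.
  by rewrite ler_pdivrMr ?exprn_gt0 //; nra.
have small e : 0 < e -> {ae P, forall w, \forall k \near \oo,
    forall n, gf_error (z k) (T n w) < e}.
  move=> e0; pose F k := bad (gf_error (z (k + K)%N)) e.
  have PF k : (P (F k) <= (16 * C / e * k.+1%:R ^- 2)%:E)%E.
    have zk := zK (k + K)%N (leq_addl _ _).
    apply: le_trans (@submartingale_maximal _ _ _ P T chainT _ _ _ e0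
      (@gf_error_ge0 _ _) (gf_error_le_child_mean zk) (mean_gf_error_le zk)) _.
    rewrite lee_fin [leRHS]mulrAC ler_wpM2r ?invr_ge0 ?(ltW e0) //.
    rewrite -mulrA ler_wpM2l // (le_trans (zC _)) // ler_wpM2l //.
    rewrite lef_pV2 ?posrE ?exprn_gt0 // lerXn2r ?nnegrE //.
    by rewrite ler_nat ltnS leq_addr.
  have sumF : (\sum_(k <oo) P (F k) < +oo)%E.
    apply: (@le_lt_trans _ _ (16 * C / e * 2)%:E); last exact: ltry.
    apply: lime_le; first exact: is_cvg_nneseries.
    apply: nearW => n.
    apply: (@le_trans _ _ (\sum_(0 <= k < n) (16 * C / e * k.+1%:R ^- 2)%:E)%E).
      exact: lee_sum.
    rewrite sumEFin lee_fin -mulr_sumr ler_wpM2l //.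
      by rewrite divr_ge0 ?(ltW e0) // mulr_ge0.
    apply: (le_trans (sum_inv_sq_le _ _)); rewrite gerBl.
    by case: n => // n; rewrite invr_ge0.
  exists (lim_sup_set F); split.
  - apply: bigcapT_measurable => n.
    by apply: bigcup_measurable => k _; exact: measurable_bad.
  - by apply: lim_sup_set_cvg0 => // k; exact: measurable_bad.
  - move=> w /= nw n _; apply: contrapT => hn; apply: nw.
    exists (n + K)%N => // k /= nk i; rewrite ltNge; apply/negP => ei.
    apply: hn; exists (k - K)%N => /=; first by lia.
    by exists i; rewrite subnK ?ei ?orbT //; lia.
have /ae_foralln h (m : nat) := small m.+1%:R^-1 ltac:(by rewrite invr_gt0).
apply: filterS h => w hw e e0.
have := hw (Num.truncn e^-1); apply: filterS => k hk n.
apply: lt_le_trans (hk n) _; rewrite -[leRHS]invrK lef_pV2 ?posrE ?invr_gt0 //.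
by rewrite ltW // truncnS_gt.
Qed.

End almost_sure.

(** * Characteristic function and first moment of the profile *)

Lemma expRN_lipschitz (R : realType) (a b : R) : 0 <= a -> 0 <= b ->
  `|expR (- a) - expR (- b)| <= `|a - b|.
Proof.
move=> a0 b0; wlog ab : a b a0 b0 / a <= b.
  by move=> W; have [/W|/ltW/W] := leP a b; [apply|rewrite distrC (distrC a); apply].
have -> : expR (- a) - expR (- b) = expR (- a) * (1 - expR (- (b - a))).
  by rewrite mulrBr mulr1 -expRD; congr (_ - expR _); ring.
have d0 : 0 <= b - a by rewrite subr_ge0.
have [h1 h2 _] := expRN_bounds d0; have [h3 _ _] := expRN_bounds a0.
rewrite ger0_norm ?mulr_ge0 ?expR_ge0 ?subr_ge0 // distrC ger0_norm //.
apply: (@le_trans _ _ (1 - expR (- (b - a)))); last by lra.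
by rewrite ler_piMl ?subr_ge0.
Qed.

Section profile_estimates.
Variable R : realType.
Local Notation normc := (@Normc.normc R).

Variables (t : rtree) (n k : nat).
Hypothesis size_t : size t = n.
Hypothesis n_gt0 : (0 < n)%N.
Hypothesis k_ge2 : (2 <= k)%N.
Hypothesis k_ln : (k%:R : R) ^+ 2 <= ln (n%:R : R) <= k.+1%:R ^+ 2.

Let l : R := ln n%:R.
Let h : R := harm R n.
Let kr : R := k%:R.

Let k2 : 2 <= kr. Proof. by rewrite /kr ler_nat. Qed.
Let k0 : 0 < kr. Proof. by have := k2; lra. Qed.
Let lk : kr ^+ 2 <= l <= (kr + 1) ^+ 2.
Proof. by move: k_ln; rewrite -natr1. Qed.
Let hl : `|h - l| <= 1. Proof. exact: harm_ln. Qed.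
Let n0 : 0 < n%:R :> R. Proof. by rewrite ltr0n. Qed.

Let h0 : 0 <= h.
Proof. by rewrite /h /harm sumr_ge0 // => i _; rewrite invr_ge0. Qed.

Let h_le : h <= 5 * kr ^+ 2.
Proof.
have /andP[_ l2] := lk; have /ler_normlP[_ hl2] := hl; have := k2; nra.
Qed.

Let inv_n : n%:R^-1 <= kr^-1.
Proof.
rewrite lef_pV2 ?posrE //; have /andP[l1 _] := lk.
have := @ln_sublinear R n%:R n0; rewrite -/l; have := k2; nra.
Qed.

Let ratio_n : n.+1%:R / n%:R <= 2 :> R.
Proof.
rewrite ler_pdivrMr // -natr1; have : 1 <= n%:R :> R by rewrite ler1n.
lra.
Qed.

(** The difference is split into the deviation of the martingale from its mean
    together with the discrepancy between [n] and [n.+1] nodes, the Gaussian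
    approximation of the mean, the centring by [ln n] in place of the harmonic
    number, and the variance [kr ^ 2] in place of the harmonic number. *)
Lemma charfun_near (theta : R) : 2 * `|theta| <= kr ->
  normc (n%:R^-1 * (\sum_(e <- depths t) expi (theta / kr * (e%:R - l))) -
         (expR (- (theta ^+ 2 / 2)))%:C%C) <=
  2 * normc (gf_mart (expi (theta / kr)) t - 1) +
  (1 + `|theta| + 6 * `|theta| ^+ 2 + 10 * `|theta| ^+ 3) / kr.
Proof.
move=> theta_k.
set u := theta / kr; set M := gf_mart _ t.
have uE : `|u| = `|theta| / kr by rewrite normrM (gtr0_norm (_ : 0 < kr^-1)) ?invr_gt0.
have u_half : `|u| <= 1 / 2 by rewrite uE ler_pdivrMr //; lra.
have u_sqr : u ^+ 2 = `|u| ^+ 2 by rewrite real_normK ?num_real.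
have z1 : sqnorm (expi u - 1) <= 1 / 4.
  rewrite -normc_sqr; have := normc_expi_sub u 0; rewrite subr0 expi0 => le_u.
  by have := normc_ge0 (expi u - 1); nra.
have a0 := mean_gf_neq0 z1 n.
set q := mean_gf (expi u) n / n.+1%:R.
have N0 : n.+1%:R != 0 :> R[i] by rewrite pnatr_eq0.
have nC0 : n%:R != 0 :> R[i] by rewrite pnatr_eq0 -lt0n.
have sumE : \sum_(e <- depths t) expi (u * (e%:R - l)) =
    n.+1%:R * M * q * expi (- (u * l)).
  rewrite (eq_bigr (fun e => expi u ^+ e * expi (- (u * l)))); last first.
    by move=> e _; rewrite -expiMn -expiD mulrBr.
  rewrite -mulr_suml -/(depth_gf _ _); congr (_ * _).
  rewrite /q /M /gf_mart size_t; move: (mean_gf _ _) (depth_gf _ _) a0 => a D a0.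
  by move: (n.+1%:R : R[i]) N0 => N N0; field; rewrite N0 a0.
set g := expR (- (u ^+ 2 / 2 * h)).
set G := expR (- (theta ^+ 2 / 2)).
have q1 : normc q <= 1 by exact: normc_mean_gf_expi.
have qg : normc (q - g%:C%C * expi (u * h)) <= 2 * `|u| ^+ 3 * h + 4 * u ^+ 2.
  by apply: mean_gf_expi; lra.
have g01 : 0 <= g <= 1.
  by rewrite expR_ge0 expR_le1 oppr_le0 mulr_ge0 ?divr_ge0 ?sqr_ge0.
have hk : `|h - kr ^+ 2| <= 2 * kr + 2.
  have /andP[l1 l2] := lk; have /ler_normlP[h1 h2] := hl.
  by rewrite ler_norml; apply/andP; split; nra.
have T4 : `|g - G| <= 2 * `|theta| ^+ 2 / kr.
  apply: (le_trans (expRN_lipschitz _ _)).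
  - by rewrite mulr_ge0 ?divr_ge0 ?sqr_ge0.
  - by rewrite divr_ge0 ?sqr_ge0.
  have -> : u ^+ 2 / 2 * h - theta ^+ 2 / 2 = theta ^+ 2 / kr ^+ 2 / 2 * (h - kr ^+ 2).
    by rewrite /u; field; rewrite gt_eqF.
  rewrite normrM ger0_norm ?divr_ge0 ?sqr_ge0 // -(real_normK (num_real theta)).
  apply: (le_trans (ler_wpM2l _ hk)); first by rewrite !divr_ge0 ?sqr_ge0.
  rewrite -subr_ge0 (_ : _ - _ = `|theta| ^+ 2 * (kr - 1) / kr ^+ 2); last first.
    by field; rewrite gt_eqF.
  by rewrite divr_ge0 ?mulr_ge0 ?sqr_ge0 //; have := k2; lra.
rewrite sumE; clearbody q.
have -> : n%:R^-1 * (n.+1%:R * M * q * expi (- (u * l))) - G%:C%C =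
  (n.+1%:R / n%:R * (M - 1) + n%:R^-1) * (q * expi (- (u * l))) +
  (q - g%:C%C * expi (u * h)) * expi (- (u * l)) +
  (g%:C%C * (expi (u * h - u * l) - 1) + (g - G)%:C%C).
  rewrite expiD rmorphB /= -[n.+1%:R]natr1.
  by move: (n%:R : R[i]) nC0 => nC nC0; field.
apply: (le_trans (normc_add _ _)).
apply: (le_trans (lerD (normc_add _ _) (normc_add _ _))).
rewrite !normc_mul !normc_expi !mulr1 !normc_real.
have T1 : normc (n.+1%:R / n%:R * (M - 1) + n%:R^-1) * normc q <=
    2 * normc (M - 1) + kr^-1.
  apply: (@le_trans _ _ (normc (n.+1%:R / n%:R * (M - 1) + n%:R^-1))).
    by rewrite ler_piMr ?normc_ge0.
  apply: (le_trans (normc_add _ _)); rewrite normc_mul.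
  have -> : n.+1%:R / n%:R = (n.+1%:R / n%:R : R)%:C%C by rewrite rmorphM fmorphV !rmorph_nat.
  have -> : n%:R^-1 = (n%:R^-1 : R)%:C%C by rewrite fmorphV rmorph_nat.
  rewrite !normc_real !ger0_norm ?invr_ge0 ?divr_ge0 //.
  by rewrite lerD // ler_wpM2r ?normc_ge0.
have T3 : `|g| * normc (expi (u * h - u * l) - 1) <= `|u|.
  have /andP[g0 g1] := g01; rewrite (ger0_norm g0).
  apply: (@le_trans _ _ (normc (expi (u * h - u * l) - 1))).
    by rewrite ler_piMl ?normc_ge0.
  have := normc_expi_sub (u * h - u * l) 0; rewrite expi0 subr0 => /le_trans; apply.
  by rewrite -mulrBr normrM ler_piMr.
have T2 : 2 * `|u| ^+ 3 * h + 4 * u ^+ 2 <=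
    (10 * `|theta| ^+ 3 + 4 * `|theta| ^+ 2) / kr.
  rewrite u_sqr uE.
  have e1 : 2 * (`|theta| / kr) ^+ 3 * h <= 10 * `|theta| ^+ 3 / kr.
    have -> : 10 * `|theta| ^+ 3 / kr = 2 * (`|theta| / kr) ^+ 3 * (5 * kr ^+ 2).
      by field; rewrite gt_eqF.
    by rewrite ler_wpM2l // mulr_ge0 // exprn_ge0 // divr_ge0 // ltW.
  have e2 : 4 * (`|theta| / kr) ^+ 2 <= 4 * `|theta| ^+ 2 / kr.
    rewrite -subr_ge0 (_ : _ - _ = 4 * `|theta| ^+ 2 * (kr - 1) / kr ^+ 2); last first.
      by field; rewrite gt_eqF.
    by rewrite divr_ge0 ?mulr_ge0 ?sqr_ge0 //; have := k2; lra.
  by rewrite mulrDl; lra.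
apply: le_trans (lerD (lerD T1 (le_trans qg T2)) (lerD T3 T4)) _.
by rewrite uE; lra.
Qed.

Lemma mean_gf_real_le (x : R) : 0 < x ->
  0 < mean_gf x n <= n.+1%:R * expR ((x - 1) * h).
Proof.
move=> x0; rewrite /h; elim: n => [|m IH].
  by rewrite /mean_gf /harm !big_ord0 mulr0 expR0 mulr1 ltr01 lexx.
have /andP[m0 mle] := IH; rewrite mean_gfS.
have f0 : 0 < 1 + x / m.+1%:R by rewrite addr_gt0 // divr_gt0.
rewrite mulr_gt0 //=.
have -> : (x - 1) * harm R m.+1 = (x - 1) * harm R m + (x - 1) / m.+2%:R.
  by rewrite /harm big_ord_recr /= mulrDr.
have e1 := expR_ge1Dx ((x - 1) / m.+2%:R).
rewrite expRD mulrA.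
apply: (@le_trans _ _ (m.+1%:R * expR ((x - 1) * harm R m) * (1 + x / m.+1%:R))).
  by rewrite ler_wpM2r // ltW.
rewrite mulrAC [leRHS]mulrAC ler_wpM2r ?expR_ge0 //.
apply: le_trans (ler_wpM2l _ e1); last exact: ler0n.
rewrite le_eqVlt; apply/orP; left; apply/eqP.
rewrite -[m.+2%:R]natr1; have : 0 < m.+1%:R :> R by [].
by move: (m.+1%:R : R) => N N0; field; rewrite !gt_eqF // ltr_wpDr.
Qed.

Lemma gf_mart_real (x : R) : gf_mart (x%:C%C) t = (gf_mart x t)%:C%C.
Proof.
rewrite /gf_mart rmorphM fmorphV /=; congr (_ / _).
  by rewrite /depth_gf rmorph_sum; apply: eq_bigr => e _; rewrite rmorphXn.
rewrite /mean_gf rmorph_prod; apply: eq_bigr => i _.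
by rewrite rmorphD rmorphM fmorphV rmorph_nat.
Qed.

(** The mean is at most [n.+1 * exp ((exp v - 1) * h)].  With [|v| = 1/k]
    and [h] at most [5 * k ^ 2], the exponent exceeds [v * ln n] by at most
    [v * (h - ln n) + 2 * v ^ 2 * h <= 1 + 10]. *)
Lemma mgf_near (v : R) : `|v| = kr^-1 ->
  gf_error (expR v)%:C%C t <= 1 ->
  n%:R^-1 * (\sum_(e <- depths t) expR (v * (e%:R - l))) <= 4 * expR 11.
Proof.
move=> vk err; set x := expR v.
have x0 : 0 < x by exact: expR_gt0.
have M2 : gf_mart x t <= 2.
  move: err; rewrite /gf_error gf_mart_real -rmorphB /sqnorm /= expr0n addr0.
  by move: (gf_mart x t) => m; nra.
have /andP[a0 ale] := mean_gf_real_le x0.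
rewrite (eq_bigr (fun e => x ^+ e * expR (- (v * l)))); last first.
  by move=> e _; rewrite -expRM_natr -expRD mulrBr.
rewrite -mulr_suml -/(depth_gf _ _).
have -> : depth_gf x t = gf_mart x t * mean_gf x n.
  by rewrite /gf_mart size_t divfK // gt_eqF.
have hE : (x - 1) * h - v * l <= 11.
  have v1 : v <= 1 / 2.
    apply: (le_trans (ler_norm v)); rewrite vk.
    by rewrite invf_ple ?posrE //; have := k2; lra.
  have xv := expR_quadratic v1.
  have e1 : (x - 1) * h <= (v + 2 * v ^+ 2) * h by rewrite ler_wpM2r //; rewrite /x; lra.
  have v2 : v ^+ 2 = kr ^- 2 by rewrite -(real_normK (num_real v)) vk exprVn.
  have e2 : v ^+ 2 * h <= 5.
    rewrite v2 mulrC ler_pdivrMr ?exprn_gt0 //; exact: h_le.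
  have e3 : v * (h - l) <= 1.
    apply: (le_trans (ler_norm _)); rewrite normrM vk.
    rewrite mulr_ile1 ?invr_ge0 ?(ltW k0) // invf_le1 //; have := k2; lra.
  by move: (x) (h) (l) e1 e2 e3 => x' h' l' e1 e2 e3; lra.
have m0 : 0 <= gf_mart x t.
  rewrite /gf_mart size_t divr_ge0 ?(ltW a0) // sumr_ge0 // => e _.
  by rewrite exprn_ge0 // ltW.
apply: (@le_trans _ _ (n%:R^-1 * (2 * (n.+1%:R * expR ((x - 1) * h)) * expR (- (v * l))))).
  rewrite ler_wpM2l ?invr_ge0 // ler_wpM2r ?expR_ge0 //.
  by apply: ler_pM => //; exact: ltW.
have -> : n%:R^-1 * (2 * (n.+1%:R * expR ((x - 1) * h)) * expR (- (v * l))) =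
  2 * (n.+1%:R / n%:R) * expR ((x - 1) * h - v * l).
  by rewrite expRD; ring.
apply: ler_pM; rewrite ?expR_ge0 ?ler_expR //.
by have := ratio_n; lra.
Qed.

Let s : R := Num.sqrt l.

(** Follows from [|y| <= exp y + exp (- y)]. *)
Lemma abs_moment_near :
  gf_error (expR kr^-1)%:C%C t <= 1 -> gf_error (expR (- kr^-1))%:C%C t <= 1 ->
  n%:R^-1 * (\sum_(e <- depths t) `|kr^-1 * (e%:R - l)|) <= 8 * expR 11.
Proof.
move=> e1 e2.
have nk : `|kr^-1| = kr^-1 by rewrite ger0_norm ?invr_ge0 ?(ltW k0).
have h1 := mgf_near nk e1.
have nk' : `|- kr^-1| = kr^-1 by rewrite normrN.
have h2 := mgf_near nk' e2.
have -> : 8 * expR 11 = 4 * expR 11 + 4 * expR 11 :> R by ring.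
apply: le_trans (lerD h1 h2); rewrite -mulrDr ler_wpM2l ?invr_ge0 //.
rewrite -big_split /=; apply: ler_sum => e _; rewrite mulNr.
move: (kr^-1 * _) => y; have p1 := expR_ge1Dx y; have p2 := expR_ge1Dx (- y).
have p3 := expR_ge0 y; have p4 := expR_ge0 (- y).
move: (expR y) (expR (- y)) p1 p2 p3 p4 => a b p1 p2 p3 p4.
by rewrite ler_norml {h1 h2 e1 e2}; apply/andP; split; lra.
Qed.

Let s_ge : kr <= s.
Proof.
have /andP[l1 _] := lk; rewrite -(@ger0_norm _ kr) ?(ltW k0) // -sqrtr_sqr.
by rewrite ler_wsqrtr.
Qed.

Let s_le : s <= kr + 1.
Proof.
have /andP[_ l2] := lk; have kk : 0 <= kr + 1 by have := k0; lra.
by rewrite -(ger0_norm kk) -sqrtr_sqr ler_wsqrtr.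
Qed.

Lemma abs_moment_sqrt :
  gf_error (expR kr^-1)%:C%C t <= 1 -> gf_error (expR (- kr^-1))%:C%C t <= 1 ->
  n%:R^-1 * (\sum_(e <- depths t) `|s^-1 * (e%:R - l)|) <= 8 * expR 11.
Proof.
move=> e1 e2; apply: le_trans (abs_moment_near e1 e2).
rewrite ler_wpM2l ?invr_ge0 //; apply: ler_sum => e _.
have s0 : 0 < s by exact: lt_le_trans s_ge.
rewrite !normrM ler_wpM2r // !ger0_norm ?invr_ge0 ?(ltW s0) ?(ltW k0) //.
by rewrite lef_pV2 ?posrE.
Qed.

(** Replacing the rounded scale by the square root of [ln n] costs only the
    bounded first moment times the relative rounding error. *)
Lemma charfun_sqrt (theta : R) : 2 * `|theta| <= kr ->
  gf_error (expR kr^-1)%:C%C t <= 1 -> gf_error (expR (- kr^-1))%:C%C t <= 1 ->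
  normc (n%:R^-1 * (\sum_(e <- depths t) expi (theta * (s^-1 * (e%:R - l)))) -
         (expR (- (theta ^+ 2 / 2)))%:C%C) <=
  2 * normc (gf_mart (expi (theta / kr)) t - 1) +
  (1 + (1 + 8 * expR 11) * `|theta| + 6 * `|theta| ^+ 2 + 10 * `|theta| ^+ 3) / kr.
Proof.
move=> th e1 e2.
have s0 : 0 < s by exact: lt_le_trans s_ge.
have nV : n%:R^-1 = (n%:R^-1 : R)%:C%C by rewrite fmorphV rmorph_nat.
have near := charfun_near th.
set A := _ * \sum_(e <- depths t) expi (theta / kr * _) in near *.
set B := _ * \sum_(e <- depths t) _; set G := (expR _)%:C%C in near *.
have AB : normc (B - A) <= 8 * expR 11 * `|theta| / kr.
  rewrite /A /B -mulrBr -sumrB normc_mul nV normc_real ger0_norm ?invr_ge0 //.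
  apply: (@le_trans _ _ (n%:R^-1 * (\sum_(e <- depths t) `|theta| / kr * `|kr^-1 * (e%:R - l)|))).
    rewrite ler_wpM2l ?invr_ge0 //; apply: (le_trans (normc_sum _ _)).
    apply: ler_sum => e _; apply: (le_trans (normc_expi_sub _ _)).
    have -> : theta * (s^-1 * (e%:R - l)) - theta / kr * (e%:R - l) =
      theta * ((kr - s) / s) * (kr^-1 * (e%:R - l)).
      by field; rewrite !gt_eqF.
    rewrite normrM ler_wpM2r // normrM ler_wpM2l // normrM distrC.
    have ks := s_ge; have sk := s_le.
    have d0 : 0 <= s - kr by rewrite subr_ge0.
    have i0 : 0 <= s^-1 by rewrite invr_ge0 ltW.
    rewrite (ger0_norm d0) (ger0_norm i0).
    apply: (@le_trans _ _ (1 * s^-1)); last by rewrite mul1r lef_pV2 ?posrE.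
    by rewrite ler_wpM2r ?invr_ge0 ?(ltW s0) //; lra.
  rewrite -mulr_sumr mulrCA.
  apply: (le_trans (ler_wpM2l _ (abs_moment_near e1 e2))).
    by rewrite divr_ge0 // ltW.
  by rewrite le_eqVlt; apply/orP; left; apply/eqP; ring.
have -> : B - G = (B - A) + (A - G) by ring.
apply: (le_trans (normc_add _ _)); apply: (le_trans (lerD AB near)).
by rewrite !mulrDl !mul1r; lra.
Qed.

End profile_estimates.

(** * Polynomial approximation *)

Section weierstrass.
Variable R : realType.
Implicit Types (g : nat -> R) (x : R).

(** The [n]-th Bernstein mean, the expectation of [g] at a binomial variable,
    by conditioning on the first trial. *)
Fixpoint bernstein n g : {poly R} :=
  if n is m.+1 then 'X * bernstein m (g \o succn) + (1 - 'X) * bernstein m g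
  else (g 0)%:P.

Lemma bernsteinS n g x : (bernstein n.+1 g).[x] =
  x * (bernstein n (g \o succn)).[x] + (1 - x) * (bernstein n g).[x].
Proof. by rewrite /= !hornerE. Qed.

Lemma bernstein_affine n (a b c : R) g1 g2 x :
  (bernstein n (fun k => a * g1 k + b * g2 k + c)).[x] =
  a * (bernstein n g1).[x] + b * (bernstein n g2).[x] + c.
Proof.
elim: n g1 g2 => [|n IH] g1 g2; first by rewrite /= !hornerC.
rewrite !bernsteinS IH.
have := IH (g1 \o succn) (g2 \o succn); rewrite /comp => ->; ring.
Qed.

Lemma bernstein_le n g1 g2 x : 0 <= x <= 1 -> (forall k, (k <= n)%N -> g1 k <= g2 k) ->
  (bernstein n g1).[x] <= (bernstein n g2).[x].
Proof.
move=> /andP[x0 x1]; elim: n g1 g2 => [|n IH] g1 g2 h.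
  by rewrite /= !hornerC h.
rewrite !bernsteinS lerD // ler_wpM2l ?subr_ge0 //; apply: IH => k kn.
  exact: h.
by apply: h; rewrite leqW.
Qed.

(** Bias and variance of a binomial variable. *)
Lemma bernstein_sq n (a : R) x :
  (bernstein n (fun k => (k%:R - a) ^+ 2)).[x] =
  n%:R * x * (1 - x) + (n%:R * x - a) ^+ 2.
Proof.
elim: n a => [|n IH] a; first by rewrite /= hornerC; ring.
rewrite bernsteinS IH.
have -> : (fun k : nat => (k%:R - a) ^+ 2) \o succn =
    (fun k : nat => (k%:R - (a - 1)) ^+ 2).
  by apply/funext => k /=; rewrite -natr1; ring.
by rewrite IH -natr1; ring.
Qed.

(** Only one of the two points has to lie in the segment. *)
Lemma unif_continuous_segment (f : R -> R) (a b e : R) : continuous f -> 0 < e ->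
  exists2 del, 0 < del & forall x y, a <= x <= b -> `|x - y| < del ->
    `|f x - f y| < e.
Proof.
move=> cf e0.
have /compact_near_coveringP cov := @segment_compact R a b.
have := cov R 0^'+ (fun del x => forall y, `|x - y| < del -> `|f x - f y| < e).
case=> [x _|del /= del0 hdel].
- have := cf x => /cvgrPdist_lt /(_ (e / 2)) [|r /= r0 hr]; first by rewrite divr_gt0.
  exists (ball x (r / 2), [set del | del < r / 2]) => /=.
    split; first by exists (r / 2) => //=; rewrite divr_gt0.
    by apply: nbhs_right_lt; rewrite divr_gt0.
  move=> [x' del] /= [xx' dr] y x'y.
  have h1 : `|f x - f x'| < e / 2 by apply: hr; rewrite /= (lt_trans xx') //; lra.
  have h2 : `|f x - f y| < e / 2.
    apply: hr => /=; rewrite (_ : x - y = (x - x') + (x' - y)); last by ring.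
    by apply: le_lt_trans (ler_normD _ _) _; move: xx'; rewrite /ball /=; lra.
  rewrite (_ : f x' - f y = (f x - f y) - (f x - f x')); last by ring.
  by apply: le_lt_trans (ler_normB _ _) _; lra.
- exists (del / 2); first by rewrite divr_gt0.
  move=> x y xab xy; apply: (hdel (del / 2)) => //=.
  + by rewrite sub0r normrN gtr0_norm ?divr_gt0 //; lra.
  + by rewrite divr_gt0.
Qed.

(** Chebyshev's inequality under the Bernstein mean: [|f (k / n) - f x|] is at most
    [e / 2] plus a multiple of [(k - n * x) ^ 2], whose mean is a binomial
    variance. *)
Lemma weierstrass01 (f : R -> R) (e : R) : continuous f -> 0 < e ->
  exists p : {poly R}, forall x, 0 <= x <= 1 -> `|p.[x] - f x| <= e.
Proof.
move=> cf e0.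
have e2 : 0 < e / 2 by rewrite divr_gt0.
have [del del0 hdel] := @unif_continuous_segment f 0 1 (e / 2) cf e2.
have [M M0 hM] : exists2 M, 0 <= M & forall x, 0 <= x <= 1 -> `|f x| <= M.
  have cnf : {within `[0, 1], continuous (fun y => `|f y|)}.
    by apply: continuous_subspaceT => y; apply: cvg_norm; exact: cf.
  have [c _ hc] := @EVT_max R (fun y => `|f y|) 0 1 ler01 cnf.
  by exists `|f c| => // y y01; apply: hc; rewrite in_itv.
pose n := (Num.truncn (4 * M / (del ^+ 2 * e))).+1.
have n0 : 0 < n%:R :> R by [].
have nM : 4 * M / (del ^+ 2 * e) <= n%:R by rewrite ltW // truncnS_gt.
pose g (k : nat) := f (k%:R / n%:R).
exists (bernstein n g) => x x01; have /andP[x0 x1] := x01.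
pose a := 2 * M / (del ^+ 2 * n%:R ^+ 2).
have a0 : 0 <= a by apply: divr_ge0; apply: mulr_ge0; rewrite ?sqr_ge0.
have gk k : (k <= n)%N -> `|g k - f x| <= a * (k%:R - n%:R * x) ^+ 2 + e / 2.
  move=> kn; rewrite /g distrC.
  have k01 : 0 <= (k%:R / n%:R : R) <= 1.
    by rewrite divr_ge0 //= ler_pdivrMr // mul1r ler_nat.
  have [xk|xk] := ltP `|x - k%:R / n%:R| del.
    apply: (le_trans (ltW (hdel _ _ x01 xk))); rewrite lerDr.
    by rewrite mulr_ge0 ?sqr_ge0.
  apply: (@le_trans _ _ (2 * M)).
    apply: (le_trans (ler_normB _ _)).
    by have h1 := hM _ x01; have h2 := hM _ k01; lra.
  rewrite -[leLHS]addr0 lerD ?divr_ge0 ?(ltW e0) //.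
  rewrite (_ : a * _ = 2 * M * (`|x - k%:R / n%:R| / del) ^+ 2); last first.
    rewrite exprMn real_normK ?num_real // /a.
    by move: (n%:R : R) n0 => N N0; field; rewrite !gt_eqF.
  rewrite ler_peMr ?mulr_ge0 // exprn_ege1 // ler_pdivlMr // mul1r.
  exact: xk.
have an : a * (n%:R * x * (1 - x)) <= e / 2.
  apply: (@le_trans _ _ (a * n%:R)).
    rewrite ler_wpM2l // -mulrA ler_piMr //; nra.
  rewrite (_ : a * n%:R = 2 * M / (del ^+ 2 * n%:R)); last first.
    by rewrite /a; move: (n%:R : R) n0 => N N0; field; rewrite !gt_eqF.
  move: nM; rewrite !ler_pdivrMr ?mulr_gt0 ?exprn_gt0 //; lra.
have mean c s : (bernstein n (fun k => s * (k%:R - n%:R * x) ^+ 2 + 0 * 0 + c)).[x] =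
    s * (n%:R * x * (1 - x)) + c.
  rewrite (bernstein_affine n s 0 c (fun k => (k%:R - n%:R * x) ^+ 2) (fun=> 0)).
  by rewrite bernstein_sq subrr expr0n addr0 mul0r addr0.
rewrite ler_norml; apply/andP; split.
  apply: (@le_trans _ _ ((bernstein n (fun k => - a * (k%:R - n%:R * x) ^+ 2 + 0 * 0 +
      (f x - e / 2))).[x] - f x)); first by rewrite mean; lra.
  rewrite lerD2r bernstein_le // => k /gk /ler_normlP[]; lra.
rewrite lerBlDr.
apply: (@le_trans _ _ ((bernstein n (fun k => a * (k%:R - n%:R * x) ^+ 2 + 0 * 0 +
      (f x + e / 2))).[x])); last by rewrite mean; lra.
by rewrite bernstein_le // => k /gk /ler_normlP[]; lra.
Qed.

End weierstrass.

(** * Gaussian integrals *)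

Section gaussian.
Variable R : realType.
Local Notation mu := (@lebesgue_measure R).

Let phi : R -> R := normal_pdf 0 1.

Let c0 : R := normal_peak 1.

Let c0_gt0 : 0 < c0. Proof. by rewrite normal_peak_gt0 // oner_neq0. Qed.

Let phiE : phi = fun x => c0 * expR (- (x ^+ 2 / 2)).
Proof.
apply/funext => x; rewrite /phi normal_pdfE ?oner_neq0 // /normal_fun subr0.
by rewrite expr1n mulNr.
Qed.

Let phi_ge0 x : 0 <= phi x. Proof. exact: normal_pdf_ge0. Qed.

Let phi_cont : continuous phi.
Proof. by apply: continuous_normal_pdf; rewrite oner_neq0. Qed.

Let phi_deriv (x : R) : is_derive x 1 phi (- x * phi x).
Proof.
rewrite phiE.
have h : is_derive x 1 (fun y : R => - (y ^+ 2 / 2)) (- x).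
  apply: is_derive_eq; rewrite /GRing.scale /=; lra.
have := @is_derive1_comp _ expR (fun y : R => - (y ^+ 2 / 2)) x _ _ _ h.
move=> hc; apply: is_derive_eq.
by rewrite /GRing.scale /=; lra.
Qed.

(** A centred Gaussian density of variance 2 absorbs the linear factor. *)
Let integrable_linear_growth (f : R -> R) (a b : R) : continuous f ->
  (forall x, `|f x| <= a + b * `|x|) ->
  mu.-integrable setT (fun x => (f x * phi x)%:E).
Proof.
move=> cf fab.
have a0 : 0 <= a by have := fab 0; rewrite normr0 mulr0 addr0; apply: le_trans.
pose s : R := Num.sqrt 2.
have s2 : s ^+ 2 = 2 by rewrite sqr_sqrtr.
have s0 : s != 0 by rewrite gt_eqF // sqrtr_gt0.
pose C := (a + `|b|) * c0 / normal_peak s.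
have ps0 : 0 < normal_peak s by rewrite normal_peak_gt0.
have := integrableZl measurableT C (integrable_normal_pdf 0 s).
apply: le_integrable => //.
  apply/measurable_EFinP; apply: measurable_funM.
    exact: continuous_measurable_fun.
  exact: measurable_normal_pdf.
move=> x _ /=; rewrite lee_fin normrM (ger0_norm (phi_ge0 x)).
rewrite [leRHS]ger0_norm; last first.
  by rewrite !mulr_ge0 ?normal_pdf_ge0 ?invr_ge0 ?addr_ge0 ?(ltW ps0) ?(ltW c0_gt0).
rewrite normal_pdfE // /normal_fun subr0 s2 phiE.
have -> : - x ^+ 2 / (2 *+ 2) = x ^+ 2 / 4 - x ^+ 2 / 2 :> R.
  by rewrite -(mulr_natr 2 2) -natrM; lra.
rewrite expRD.
have -> : C * (normal_peak s * (expR (x ^+ 2 / 4) * expR (- (x ^+ 2 / 2)))) =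
  (a + `|b|) * expR (x ^+ 2 / 4) * (c0 * expR (- (x ^+ 2 / 2))).
  by rewrite /C; move: (normal_peak s) ps0 => p p0; field; rewrite gt_eqF.
apply: ler_wpM2r; first by rewrite mulr_ge0 ?expR_ge0 ?(ltW c0_gt0).
apply: (le_trans (fab x)).
have h1 := expR_ge1Dx (x ^+ 2 / 4).
have h2 : `|x| <= 1 + x ^+ 2 / 4.
  have := sqr_ge0 (`|x| / 2 - 1); rewrite -(real_normK (num_real x)); lra.
have x2 := sqr_ge0 x.
have h3 : b * `|x| <= `|b| * `|x| by rewrite ler_wpM2r // ler_norm.
have h4 : `|b| * `|x| <= `|b| * expR (x ^+ 2 / 4) by rewrite ler_wpM2l //; lra.
have h5 : a * 1 <= a * expR (x ^+ 2 / 4) by rewrite ler_wpM2l //; lra.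
by rewrite mulrDl; lra.
Qed.

(** What an integration by parts becomes once its boundary terms vanish at
    infinity. *)
Let integral_derivative (F f : R -> R) :
  (forall x : R, is_derive x 1 F (f x)) -> continuous f ->
  mu.-integrable setT (EFin \o f) ->
  F n.+1%:R @[n --> \oo] --> 0 -> F (- n.+1%:R) @[n --> \oo] --> 0 ->
  (\int[mu]_x (f x)%:E = 0)%E.
Proof.
move=> dF cf intf Fy FNy.
pose fn (n : nat) := EFin \o (f \_ `[- n.+1%:R, n.+1%:R]).
have mf : measurable_fun setT f by exact: continuous_measurable_fun.
have fn_cvg : (\int[mu]_x fn n x)%E @[n --> \oo] --> (\int[mu]_x (f x)%:E)%E.
  have [|||||_ _] := @dominated_convergence _ _ R mu setT measurableT fn
    (EFin \o f) (fun x => `|f x|%:E); last by apply.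
  - move=> n; apply/measurable_EFinP; apply/measurable_restrict => //.
    exact: measurable_funTS.
  - exact/measurable_EFinP.
  - apply: aeW => x _ /=; apply: cvg_near_cst.
    exists (Num.truncn `|x|) => // n /= xn.
    rewrite /fn /= patchE mem_set //= in_itv /= -ler_norml ltW //.
    by rewrite (lt_le_trans (truncnS_gt _)) // ler_nat.
  - by rewrite (_ : (fun _ => _) = abse \o (EFin \o f)) //; apply: integrable_abse.
  - apply: aeW => x n _; rewrite /fn /= lee_fin patchE; case: ifPn => // _.
    by rewrite normr0.
have fnE n : (\int[mu]_x fn n x)%E = (F n.+1%:R - F (- n.+1%:R))%:E.
  rewrite /fn -restrict_EFin -integral_mkcond.
  rewrite (@continuous_FTC2 _ f F) //.
  - by rewrite gtrN.
  - exact: continuous_subspaceT.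
  - have dd x : derivable F x 1 by have [] := dF x.
    have cF x : F y @[y --> x] --> F x.
      by apply: differentiable_continuous; apply/derivable1_diffP.
    by split=> [x _||]; [exact: dd|exact: cvg_at_right_filter|exact: cvg_at_left_filter].
  - by move=> x _; rewrite derive1E; apply: derive_val.
have h : (F n.+1%:R - F (- n.+1%:R))%:E @[n --> \oo] --> 0%:E.
  apply/fine_cvgP; split; first exact: nearW.
  by rewrite -[X in _ --> X](subrr 0); apply: cvgB.
move: fn_cvg; under eq_fun do rewrite fnE.
by move=> /cvg_unique; apply.
Qed.

Let affine_deriv (t a x : R) : is_derive x 1 (fun y : R => t * y + a) t.
Proof. by apply: is_derive_eq; rewrite /GRing.scale /= mulr1 addr0. Qed.

Let sin_deriv (t a x : R) :
  is_derive x 1 (fun y => sin (t * y + a)) (t * cos (t * x + a)).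
Proof.
have h := affine_deriv t a x.
have hc := @is_derive1_comp _ sin _ x _ _ _ h.
by apply: is_derive_eq; rewrite mulrC.
Qed.

Let cos_deriv (t a x : R) :
  is_derive x 1 (fun y => cos (t * y + a)) (- t * sin (t * x + a)).
Proof.
have h := affine_deriv t a x.
have hc := @is_derive1_comp _ cos _ x _ _ _ h.
by apply: is_derive_eq; rewrite mulrC mulrN mulNr.
Qed.

Let is_derive_continuous (F f : R -> R) :
  (forall x : R, is_derive x 1 F (f x)) -> continuous F.
Proof.
move=> dF x; apply: differentiable_continuous; apply/derivable1_diffP.
by have [] := dF x.
Qed.

Let sin_cont t a : continuous (fun x : R => sin (t * x + a)).
Proof. exact: is_derive_continuous (sin_deriv t a). Qed.

Let cos_cont t a : continuous (fun x : R => cos (t * x + a)).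
Proof. exact: is_derive_continuous (cos_deriv t a). Qed.

Let phi_le x : `|x| * phi x <= c0.
Proof.
rewrite phiE mulrCA ger_pMr // expRN ler_pdivrMr ?expR_gt0 // mul1r.
apply: le_trans (expR_ge1Dx _).
have := sqr_ge0 (`|x| - 1); rewrite -(real_normK (num_real x)); lra.
Qed.

Let integrable_cos t a :
  mu.-integrable setT (fun x => (cos (t * x + a) * phi x)%:E).
Proof.
apply: (@integrable_linear_growth _ 1 0); first exact: cos_cont.
by move=> x; rewrite mul0r addr0 cos_max.
Qed.

Let integrable_xsin t a :
  mu.-integrable setT (fun x => (x * sin (t * x + a) * phi x)%:E).
Proof.
apply: (@integrable_linear_growth (fun x => x * sin (t * x + a)) 0 1).
  by move=> x; apply: continuousM; [exact: cvg_id|exact: sin_cont].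
by move=> x; rewrite mul1r add0r normrM ler_piMr ?sin_max.
Qed.

(** Gaussian integration by parts against a trigonometric function. *)
Let stein (t a : R) :
  \int[mu]_x (x * sin (t * x + a) * phi x) =
  t * \int[mu]_x (cos (t * x + a) * phi x).
Proof.
pose F (x : R) := sin (t * x + a) * phi x.
pose f (x : R) := t * (cos (t * x + a) * phi x) - x * sin (t * x + a) * phi x.
have dF (x : R) : is_derive x 1 F (f x).
  have h1 := sin_deriv t a x; have h2 := phi_deriv x.
  by apply: is_derive_eq; rewrite /f /GRing.scale /=; lra.
have cf : continuous f.
  move=> x; apply: cvgB.
    apply: cvgM; first exact: cvg_cst.
    by apply: cvgM; [exact: cos_cont|exact: phi_cont].
  apply: cvgM; last exact: phi_cont.
  by apply: cvgM; [exact: cvg_id|exact: sin_cont].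
have intt : mu.-integrable setT (EFin \o (fun x => t * (cos (t * x + a) * phi x))).
  have := integrableZl measurableT t (integrable_cos t a).
  by apply: eq_integrable => // x _.
have intf : mu.-integrable setT (EFin \o f).
  have := integrableB measurableT intt (integrable_xsin t a).
  by apply: eq_integrable => // x _.
have F_small (u : nat -> R) : (forall n, `|u n| = n.+1%:R) -> F (u n) @[n --> \oo] --> 0.
  move=> un; apply/cvgr0Pnorm_le => e e0.
  exists (Num.truncn (c0 / e)) => // n /= nc.
  have n0 : 0 < n.+1%:R :> R by [].
  apply: (@le_trans _ _ (phi (u n))).
    by rewrite /F normrM (ger0_norm (phi_ge0 _)) ler_piMl ?sin_max.
  have := phi_le (u n); rewrite un mulrC -ler_pdivlMr // => /le_trans; apply.
  rewrite ler_pdivrMr // mulrC -ler_pdivrMr // ltW // (lt_le_trans (truncnS_gt _)) //.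
  by rewrite ler_nat.
have Fpos : F n.+1%:R @[n --> \oo] --> 0 by apply: F_small => n; rewrite normr_nat.
have Fneg : F (- n.+1%:R) @[n --> \oo] --> 0.
  by apply: F_small => n; rewrite normrN normr_nat.
have F0 := integral_derivative dF cf intf Fpos Fneg.
have : \int[mu]_x f x = 0 by rewrite /Rintegral F0.
rewrite /f RintegralB //; last exact: integrable_xsin.
rewrite RintegralZl //; last exact: integrable_cos.
by move/eqP; rewrite subr_eq0 => /eqP.
Qed.

(** Differentiating in [t] and integrating by parts shows that the integral
    solves [y' = - t * y]. *)
Lemma normal_cos (t a : R) :
  \int[mu]_x (cos (t * x + a) * normal_pdf 0 1 x) = cos a * expR (- (t ^+ 2 / 2)).
Proof.
rewrite -/phi; pose G (s : R) := \int[mu]_x (cos (s * x + a) * phi x).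
rewrite -/(G t).
have dG (s : R) : is_derive s 1 G (- s * G s).
  pose f (u x : R) := cos (u * x + a) * phi x.
  have df (u x : R) : is_derive u 1 (f ^~ x) (- (x * sin (u * x + a) * phi x)).
    have h : is_derive u 1 (fun v : R => v * x + a) x.
      by apply: is_derive_eq; rewrite /GRing.scale /=; lra.
    have hc := @is_derive1_comp _ cos _ u _ _ _ h.
    by apply: is_derive_eq; rewrite /GRing.scale /=; lra.
  have d1 (u x : R) : derive1 (f ^~ x) u = - (x * sin (u * x + a) * phi x).
    by rewrite derive1E; apply: derive_val.
  have sI : `]s - 1, s + 1[%classic s by rewrite /= in_itv /=; apply/andP; split; lra.
  have intf (u : R) : `]s - 1, s + 1[%classic u -> mu.-integrable setT (EFin \o f u).
    by move=> _; exact: integrable_cos.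
  have derf (u x : R) : `]s - 1, s + 1[%classic u -> setT x -> derivable (f ^~ x) u 1.
    by move=> _ _; have [] := df u x.
  have G0 (x : R) : 0 <= `|x| * phi x by rewrite mulr_ge0.
  have intG : mu.-integrable setT (EFin \o (fun x : R => `|x| * phi x)).
    apply: (@integrable_linear_growth (fun x => `|x|) 0 1); first exact: norm_continuous.
    by move=> x; rewrite normr_id add0r mul1r.
  have ubG (u x : R) : `]s - 1, s + 1[%classic u -> setT x ->
      `|partial1of2 f u x| <= `|x| * phi x.
    move=> _ _; rewrite /partial1of2 d1 normrN !normrM (ger0_norm (phi_ge0 _)).
    by rewrite -mulrA ler_wpM2l // ler_piMl ?sin_max.
  have -> : - s * G s = \int[mu]_x partial1of2 f s x.
    rewrite mulNr -stein -mulN1r -RintegralZl //; last exact: integrable_xsin.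
    by apply: eq_Rintegral => x _; rewrite /partial1of2 d1 mulN1r.
  split; first exact: (derivable_under_integral measurableT sI intf derf G0 intG ubG).
  rewrite -derive1E.
  exact: (differentiation_under_integral measurableT sI intf derf G0 intG ubG).
have dH (s : R) : is_derive s 1 (fun u => G u * expR (u ^+ 2 / 2)) 0.
  have h : is_derive s 1 (fun u : R => u ^+ 2 / 2) s.
    by apply: is_derive_eq; rewrite /GRing.scale /=; lra.
  have hc := @is_derive1_comp _ expR _ s _ _ _ h.
  have dGs := dG s.
  by apply: is_derive_eq; rewrite /GRing.scale /=; lra.
have := is_derive_0_is_cst 0 t dH.
have -> : G 0 = cos a.
  rewrite /G; transitivity (\int[mu]_x (cos a * phi x)).
    by apply: eq_Rintegral => x _; rewrite mul0r add0r.
  rewrite RintegralZl //; last exact: integrable_normal_pdf.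
  by rewrite /Rintegral integral_normal_pdf /= mulr1.
rewrite expr0n mul0r expR0 mulr1 => ->.
by rewrite expRN mulfK // gt_eqF ?expR_gt0.
Qed.

Definition linear_growth (f : R -> R) : Prop :=
  continuous f /\ exists a b, forall x, `|f x| <= a + b * `|x|.

Definition normal_mean (f : R -> R) : R :=
  \int[mu]_x (f x * normal_pdf 0 1 x).

Let integrable_lg f : linear_growth f ->
  mu.-integrable setT (fun x => (f x * phi x)%:E).
Proof. by move=> [cf [a [b fab]]]; exact: integrable_linear_growth fab. Qed.

Lemma normal_mean_linear (c : R) f g : linear_growth f -> linear_growth g ->
  normal_mean (fun x => c * f x + g x) = c * normal_mean f + normal_mean g.
Proof.
move=> /integrable_lg lf /integrable_lg lg.
have lcf : mu.-integrable setT (EFin \o (fun x => c * (f x * phi x))).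
  by have := integrableZl measurableT c lf; apply: eq_integrable => // x _.
rewrite /normal_mean -RintegralZl // -RintegralD //.
by apply: eq_Rintegral => x _; rewrite mulrDl mulrA.
Qed.

Lemma normal_mean_le f g : linear_growth f -> linear_growth g ->
  (forall x, f x <= g x) -> normal_mean f <= normal_mean g.
Proof.
move=> /integrable_lg lf /integrable_lg lg fg.
by apply: le_Rintegral => // x _; rewrite ler_wpM2r.
Qed.

Lemma integral_normal_prob (f : R -> R) : continuous f -> bounded_fun f ->
  (\int[normal_prob 0 1]_x (f x)%:E = (normal_mean f)%:E)%E.
Proof.
move=> cf [M [_ hM]].
have fM x : `|f x| <= M + 1 by apply: (hM (M + 1)); rewrite ?ltrDl.
have mf : measurable_fun setT f by exact: continuous_measurable_fun.
have lf : linear_growth f by split => //; exists (M + 1), 0 => x; rewrite mul0r addr0.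
have intf : (normal_prob (0 : R) 1).-integrable setT (EFin \o f).
  apply: (@le_integrable _ _ _ _ _ measurableT _ (cst (M + 1)%:E)).
  - exact/measurable_EFinP.
  - move=> x _ /=; rewrite lee_fin [leRHS]ger0_norm //.
    exact: le_trans (normr_ge0 _) (fM x).
  - exact: finite_measure_integrable_cst.
have dom := @normal_prob_dominates R 0 1.
rewrite -(Radon_Nikodym_change_of_variables dom measurableT intf).
transitivity (\int[mu]_x (f x * phi x)%:E)%E; last first.
  by rewrite /normal_mean /Rintegral fineK // integrable_fin_num // integrable_lg.
apply: ae_eq_integral => //.
- apply: emeasurable_funM; first exact/measurable_EFinP.
  by apply: (measurable_int mu); exact: Radon_Nikodym_integrable.
- exact: (measurable_int mu (integrable_lg lf)).
under [X in ae_eq _ _ _ X]eq_fun do rewrite EFinM.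
apply: ae_eqe_mul2l => /=.
rewrite Radon_NikodymE //=.
case: cid => /= h [h1 h2 h3].
apply: integral_ae_eq => //=.
- by apply/measurable_EFinP; exact: measurable_normal_pdf.
- by move=> E _ mE; rewrite -h3.
Qed.

End gaussian.

(** * Weak convergence from characteristic functions *)

Section weak_convergence.
Variable R : realType.

(** On [[-K, K]] the map [sin (x / K)] is injective, hence [f] is there a
    continuous function of it; a polynomial in [sin (x / K)] stays bounded on
    the whole line, which no polynomial in [x] does. *)
Lemma sin_poly_approx (f : R -> R) (B K e : R) : continuous f ->
  (forall x, `|f x| <= B) -> 0 < K -> 0 < e <= 1 ->
  exists p : {poly R}, forall x,
    `|f x - p.[sin (K^-1 * x)]| <= e + (2 * B + 1) / K * `|x|.
Proof.
move=> cf fB K0 /andP[e0 e1].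
have pi1 : 1 <= pi / 2 :> R by exact: pihalf_ge1.
pose s : R := sin 1.
have s_lt1 : s < 1.
  have c1 := cos1_gt0 R; have := sin2cos2 (1 : R); have := sin_le1 (1 : R).
  rewrite -/s => h1 h2; rewrite lt_neqAle h1 andbT; apply/eqP => h3.
  by move: h2; rewrite h3; nra.
pose cl (u : R) := Num.max (- s) (Num.min s u).
have s_gt0 : 0 < s by apply: sin2_gt0; rewrite ltr01 ltr1n.
have cl_id u : - s <= u <= s -> cl u = u.
  by move=> /andP[u1 u2]; rewrite /cl (min_idPr _) // (max_idPr _).
have cl_bnd u : -1 < cl u < 1.
  rewrite /cl lt_max gt_max ltrN2 s_lt1 /= gt_min s_lt1 /= andbT; lra.
have clc : continuous cl.
  move=> u; apply: (@continuous_max R R (fun=> - s) (Num.min s)).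
    exact: cst_continuous.
  by apply: (@continuous_min R R (fun=> s) id); [exact: cst_continuous|exact: cvg_id].
pose h (v : R) := f (K * asin (cl (2 * v - 1))).
have hc : continuous h.
  move=> v; apply: continuous_comp; last exact: cf.
  apply: cvgM; first exact: cvg_cst.
  apply: continuous_comp; last exact: continuous_asin.
  apply: (@continuous_comp R R R (fun v : R => 2 * v - 1) cl); last exact: clc.
  by apply: cvgB; [apply: cvgM; [exact: cvg_cst|exact: cvg_id]|exact: cvg_cst].
have [p hp] := weierstrass01 hc e0.
exists (p \Po (2^-1 *: ('X + 1))) => x.
rewrite horner_comp !hornerE.
set v := 2^-1 * _.
have v01 : 0 <= v <= 1.
  by rewrite /v; have := sin_le1 (K^-1 * x); have := sin_geN1 (K^-1 * x); lra.
have {hp} := hp v v01; rewrite distrC => hp.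
have B0 : 0 <= B by apply: le_trans (fB 0).
have [xK|Kx] := leP `|x| K.
  suff -> : f x = h v.
    by apply: (le_trans hp); rewrite lerDl mulr_ge0 // divr_ge0 ?(ltW K0) //; lra.
  have y1 : `|K^-1 * x| <= 1.
    by rewrite normrM gtr0_norm ?invr_gt0 // mulrC ler_pdivrMr // mul1r.
  have yin : K^-1 * x \in `[(- (pi / 2)), pi / 2].
    by rewrite in_itv /=; move/ler_normlP: y1 => [y1 y2]; lra.
  rewrite /h (_ : 2 * v - 1 = sin (K^-1 * x)); last by rewrite /v; field.
  rewrite cl_id ?sinK ?mulVKf ?gt_eqF //.
  have oin : 1 \in `[(- (pi / 2)), pi / 2 : R] by rewrite in_itv /=; lra.
  have noin : -1 \in `[(- (pi / 2)), pi / 2 : R] by rewrite in_itv /=; lra.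
  by rewrite /s -sinN !(leNgt (sin _)) !ltr_sin // -!leNgt -ler_norml.
apply: (@le_trans _ _ (2 * B + e)).
  rewrite (_ : f x - _ = (f x - h v) + (h v - p.[v])); last by ring.
  apply: (le_trans (ler_normD _ _)); rewrite lerD //.
  apply: (le_trans (ler_normB _ _)); rewrite /h.
  by have h1 := fB x; have h2 := fB (K * asin (cl (2 * v - 1))); lra.
have : 1 <= `|x| / K by rewrite ler_pdivlMr // mul1r ltW.
rewrite mulrAC -mulrA; nra.
Qed.

Variables (c : nat -> R) (xs : nat -> seq R).
Hypothesis c_ge0 : forall n, 0 <= c n.

Let L n (f : R -> R) : R := c n * \sum_(y <- xs n) f y.

Let L_linear n a f g : L n (fun x => a * f x + g x) = a * L n f + L n g.
Proof. by rewrite /L big_split /= -mulr_sumr; ring. Qed.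

Let L_le n f g : (forall x, f x <= g x) -> L n f <= L n g.
Proof. by move=> fg; rewrite ler_wpM2l // ler_sum. Qed.

Hypothesis L_cos : forall (q : rat) (a : R),
  L n (fun y => cos (ratr q * y + a)) @[n --> \oo] -->
  cos a * expR (- ((ratr q : R) ^+ 2 / 2)).
Variable C : R.
Hypothesis L_tight : \forall n \near \oo, L n (fun y => `|y|) <= C.

Let good f := linear_growth f /\ (L n f @[n --> \oo] --> normal_mean f).

Let eq_good f g : f =1 g -> good f -> good g.
Proof. by move=> /funext ->. Qed.

Let linear_growth_comb a (f g : R -> R) : linear_growth f -> linear_growth g ->
  linear_growth (fun x => a * f x + g x).
Proof.
move=> [cf [a1 [b1 h1]]] [cg [a2 [b2 h2]]]; split.
  by move=> x; apply: cvgD; [apply: cvgM; [exact: cvg_cst|exact: cf]|exact: cg].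
exists (`|a| * a1 + a2), (`|a| * b1 + b2) => x.
apply: (le_trans (ler_normD _ _)); rewrite normrM.
have := ler_wpM2l (normr_ge0 a) (h1 x); have := h2 x; lra.
Qed.

Let good_comb a f g : good f -> good g -> good (fun x => a * f x + g x).
Proof.
move=> [lf cf] [lg cg]; split; first exact: linear_growth_comb.
rewrite normal_mean_linear //; under eq_fun do rewrite L_linear.
by apply: cvgD => //; apply: cvgM => //; exact: cvg_cst.
Qed.

Let good_cos (q : rat) a : good (fun y => cos (ratr q * y + a)).
Proof.
split; last by rewrite /normal_mean normal_cos; exact: L_cos.
split; last by exists 1, 0 => x; rewrite mul0r addr0 cos_max.
move=> x; apply: continuous_comp; last exact: continuous_cos.
by apply: cvgD; [apply: cvgM; [exact: cvg_cst|exact: cvg_id]|exact: cvg_cst].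
Qed.

Let good_cst a : good (fun=> a).
Proof.
have := good_comb (a - 1) (good_cos 0 0) (good_cos 0 0).
by apply: eq_good => x; rewrite rmorph0 mul0r add0r cos0; ring.
Qed.

(** The product formula lowers the power of the sine at the cost of shifting the
    frequency. *)
Let good_sinX_cos (k : rat) m q a :
  good (fun y => sin (ratr k * y) ^+ m * cos (ratr q * y + a)).
Proof.
elim: m q a => [|m IH] q a.
  by apply: eq_good (good_cos q a) => x; rewrite expr0 mul1r.
have g1 := IH (q + k) (a - pi / 2); have g2 := IH (q - k) (a - pi / 2).
have := good_comb (2^-1) (good_comb (-1) g2 g1) (good_cst 0).
apply: eq_good => x; rewrite !addrA !cosBpihalf !rmorphD rmorphN /=.
rewrite (_ : (ratr q + ratr k) * x + a = (ratr q * x + a) + ratr k * x); last by ring.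
rewrite (_ : (ratr q - ratr k) * x + a = (ratr q * x + a) - ratr k * x); last by ring.
by move: (ratr q * x + a) (ratr k * x) => u v; rewrite sinB sinD exprS; field.
Qed.

Let good_sin_poly (k : rat) (p : {poly R}) : good (fun y => p.[sin (ratr k * y)]).
Proof.
have gm m : good (fun y => sin (ratr k * y) ^+ m).
  by apply: eq_good (good_sinX_cos k m 0 0) => x; rewrite rmorph0 mul0r add0r cos0 mulr1.
have gs n : good (fun y => \sum_(i < n) p`_i * sin (ratr k * y) ^+ i).
  elim: n => [|n IH]; first by apply: eq_good (good_cst 0) => x; rewrite big_ord0.
  by apply: eq_good (good_comb p`_n (gm n) IH) => x; rewrite big_ord_recr addrC.
by apply: eq_good (gs (size p)) => x; rewrite horner_coef.
Qed.

(** The limit is known for polynomials in [sin (x / K)], being combinations of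
    cosines; rational frequencies suffice because [K] may be an integer.  The
    error that they leave off [[-K, K]] is controlled, under the approximating
    sums and under the limit, by first moments. *)
Lemma weak_cvg_normal (f : R -> R) : continuous f -> bounded_fun f ->
  L n f @[n --> \oo] --> normal_mean f.
Proof.
move=> cf [M [_ hM]].
have fB x : `|f x| <= `|M| + 1.
  by apply: (hM (`|M| + 1)); rewrite // (le_lt_trans (ler_norm M)) // ltrDl.
set B := `|M| + 1 in fB.
have B0 : 0 < B by rewrite ltr_wpDl.
have lf : linear_growth f by split => //; exists B, 0 => x; rewrite mul0r addr0.
have labs : linear_growth (fun y : R => `|y|).
  by split; [exact: norm_continuous|exists 0, 1 => x; rewrite normr_id add0r mul1r].
pose A := `|C| + normal_mean (fun y : R => `|y|) + 4.
have nm0 : 0 <= normal_mean (fun y : R => `|y|).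
  have [l0 _] := good_cst 0.
  have <- : normal_mean (fun=> 0 : R) = 0.
    by rewrite /normal_mean /Rintegral integral0_eq // => x _; rewrite mul0r.
  by apply: normal_mean_le.
apply/cvgrPdist_le => eps eps0.
have A0 : 0 < A by rewrite /A; have := normr_ge0 C; lra.
pose e := Num.min 1 (eps / 2 / A).
have e0 : 0 < e by rewrite lt_min ltr01 !divr_gt0.
have e1 : 0 < e <= 1 by rewrite e0 ge_min lexx.
have eA : e * A <= eps / 2.
  by rewrite -ler_pdivlMr // ge_min lexx orbT.
pose K := (Num.truncn ((2 * B + 1) / e)).+1.
have K0 : 0 < K%:R :> R by [].
have KB : (2 * B + 1) / K%:R <= e.
  have := truncnS_gt ((2 * B + 1) / e); rewrite ltr_pdivrMr // => KB.
  by rewrite ler_pdivrMr // [leRHS]mulrC ltW.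
have [p hp] := sin_poly_approx cf fB K0 e1.
have kE : (K%:R : R)^-1 = ratr (K%:R^-1) by rewrite fmorphV /= ratr_nat.
pose T y := p.[sin (ratr (K%:R^-1) * y)].
have [lT LT] : good T by exact: good_sin_poly.
have fT x : `|f x - T x| <= e * `|x| + e.
  rewrite /T -kE; apply: (le_trans (hp x)); rewrite addrC lerD2r.
  by rewrite ler_wpM2r.
have [lc L1] := good_cst e.
have lbd := linear_growth_comb e labs lc.
have ldiff := linear_growth_comb (-1) lT lf.
have lbd' := linear_growth_comb (-1) lbd lc.
have n1 : normal_mean (fun=> e) = e.
  have := @normal_cos R 0 0.
  rewrite expr0n mul0r oppr0 expR0 mulr1 cos0 => E.
  rewrite /normal_mean RintegralZl //; last exact: integrable_normal_pdf.
  by rewrite /Rintegral integral_normal_pdf mulr1.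
have gap (V : (R -> R) -> R) :
    (forall a g h, linear_growth g -> linear_growth h ->
      V (fun x => a * g x + h x) = a * V g + V h) ->
    (forall g h, linear_growth g -> linear_growth h -> (forall x, g x <= h x) ->
      V g <= V h) ->
    `|V f - V T| <= e * V (fun y => `|y|) + V (fun=> e).
  move=> Vlin Vle; rewrite -(Vlin e _ _ labs lc).
  have -> : V f - V T = V (fun x => -1 * T x + f x) by rewrite Vlin //; ring.
  rewrite ler_norml; apply/andP; split; last first.
    by apply: Vle => // x; have := fT x => /ler_normlP[]; lra.
  have -> : - V (fun x => e * `|x| + e) = V (fun x => -2 * (e * `|x| + e) + (e * `|x| + e)).
    by rewrite (Vlin (-2) _ _ lbd lbd); ring.
  apply: Vle => //; first exact: linear_growth_comb.
  by move=> x; have := fT x => /ler_normlP[]; lra.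
have gap_inf : `|normal_mean f - normal_mean T| <=
    e * normal_mean (fun y : R => `|y|) + e.
  by rewrite -[X in _ <= _ + X]n1; apply: gap; [exact: normal_mean_linear|exact: normal_mean_le].
have e_le : e <= 1 by case/andP: e1.
have gap_n n : L n (fun y => `|y|) <= C -> L n (fun=> e) <= 2 * e ->
    `|L n f - L n T| <= e * `|C| + 2 * e.
  move=> h1 h2; apply: (le_trans (gap (L n) _ _)).
  - by move=> a g h _ _; exact: L_linear.
  - by move=> g h _ _; exact: L_le.
  - by rewrite lerD // ler_wpM2l ?(ltW e0) // (le_trans h1) ?ler_norm.
have L1' : \forall n \near \oo, L n (fun=> e) <= 2 * e.
  have /cvgrPdist_le /(_ e e0) := L1; apply: filterS => n.
  by rewrite n1 => /ler_normlP[]; lra.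
have LT' : \forall n \near \oo, `|normal_mean T - L n T| <= e.
  by move/cvgrPdist_le : LT; apply.
near=> n.
have h1 : L n (fun y => `|y|) <= C by near: n.
have h2 : L n (fun=> e) <= 2 * e by near: n.
have h3 : `|normal_mean T - L n T| <= e by near: n.
have h4 := gap_n n h1 h2.
have -> : normal_mean f - L n f = (normal_mean f - normal_mean T) +
  (normal_mean T - L n T) - (L n f - L n T) by ring.
apply: (le_trans (ler_normB _ _)).
apply: (le_trans (lerD (ler_normD _ _) (lexx _))).
apply: le_trans (lerD (lerD gap_inf h3) h4) _.
by move: eA eps0; rewrite /A; lra.
Unshelve. all: by end_near. Qed.

End weak_convergence.

(** * Integrals against the rescaled profile *)

Section profile_integral.
Variable R : realType.

Lemma sum_count_mem (V : nmodType) (s : seq nat) n (g : nat -> V) :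
  all (ltn^~ n) s -> \sum_(0 <= k < n) g k *+ count_mem k s = \sum_(e <- s) g e.
Proof.
elim: s => [|e s IH] /=; first by rewrite big_nil big1.
move=> /andP[en sn]; rewrite big_cons -(IH sn).
rewrite (eq_bigr _ (fun k _ => mulrnDr (g k) _ _)) big_split /=; congr (_ + _).
rewrite (bigD1_seq e) ?mem_index_iota ?iota_uniq //= eqxx mulr1n.
by rewrite big1 ?addr0 // => k /negbTE ke; rewrite eq_sym ke.
Qed.

Lemma ge0_integral_prof n (t : rtree) (g : R -> R) :
  measurable_fun setT g -> (forall x, 0 <= g x) ->
  (\int[prof R n t]_x (g x)%:E =
   (n%:R^-1 * \sum_(e <- depths t) g e%:R)%:E)%E.
Proof.
move=> mg g0; have mEg : measurable_fun setT (EFin \o g) by apply/measurable_EFinP.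
rewrite ge0_integral_mscale //=; last by move=> x _; rewrite lee_fin.
rewrite EFinM; congr (_ * _)%E.
rewrite ge0_integral_measure_series //=; last by move=> x _; rewrite lee_fin.
rewrite (eq_eseriesr (g := fun k => (g k%:R *+ level_size t k)%:E)); last first.
  move=> k _; rewrite ge0_integral_mscale //=; last by move=> x _; rewrite lee_fin.
  rewrite integral_dirac // diracT mul1e -EFinM.
  by rewrite mulr_natl.
have dt : all (ltn^~ (size t).+1) (depths t).
  by apply/(all_nthP 0%N) => i _; rewrite /= ltnS depths_bound.
apply: cvg_lim => //; apply: cvg_near_cst.
exists (size t).+1 => // m /= tm.
have hm : all (ltn^~ m) (depths t).
  by apply/allP => k /(allP dt) /= it; apply: leq_trans it tm.
rewrite sumEFin -(sum_count_mem _ hm).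
by congr EFin; apply: eq_bigr => k _; rewrite level_sizeE.
Qed.

Lemma integral_theta_prof n (t : rtree) (a b : R) (f : R -> R) :
  measurable_fun setT f ->
  (\int[theta a b (prof R n t)]_x (f x)%:E =
   (n%:R^-1 * \sum_(e <- depths t) f (a^-1 * (e%:R - b)))%:E)%E.
Proof.
move=> mf.
pose fp x := Num.max (f x) 0; pose fm x := Num.max (- f x) 0.
have mth : measurable_fun setT (theta_map a b) by exact: measurable_theta_map.
have half (g : R -> R) : measurable_fun setT g -> (forall x, 0 <= g x) ->
    (\int[theta a b (prof R n t)]_x (g x)%:E =
     (n%:R^-1 * \sum_(e <- depths t) g (a^-1 * (e%:R - b)))%:E)%E.
  move=> mg g0; have mEg : measurable_fun setT (EFin \o g) by apply/measurable_EFinP.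
  rewrite /theta (ge0_integral_pushforward mth (prof R n t) measurableT mEg); last first.
    by move=> x _; rewrite lee_fin.
  rewrite preimage_setT.
  rewrite (@ge0_integral_prof n t (g \o theta_map a b)) //=.
  exact: measurableT_comp.
have mfp : measurable_fun setT fp by apply: measurable_maxr.
have mfm : measurable_fun setT fm by apply: measurable_maxr => //; exact: measurableT_comp.
rewrite integralE.
rewrite (_ : integral _ _ _ = \int[theta a b (prof R n t)]_x (fp x)%:E)%E; last first.
  by apply: eq_integral => x _; rewrite funeposE EFin_max.
rewrite (_ : integral _ _ (_^\-) = \int[theta a b (prof R n t)]_x (fm x)%:E)%E; last first.
  by apply: eq_integral => x _; rewrite funenegE /= EFin_max.
rewrite !half => [||x||x]; rewrite ?le_max ?lexx ?orbT //.
rewrite -EFinB -mulrBr -sumrB; congr (_ * _)%:E.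
apply: eq_bigr => e _; rewrite /fp /fm; case: (lerP 0 (f (a^-1 * (e%:R - b)))) => h.
  by rewrite (max_idPr _) ?subr0 // oppr_le0.
by rewrite (max_idPl _) ?sub0r ?opprK // oppr_ge0 ltW.
Qed.

End profile_integral.

(** * Convergence of the profile *)

Section normalised_profile.
Variable R : realType.
Local Notation normc := (@Normc.normc R).

(** A scale that takes each value over a long range of times: parameters that
    depend on [n] only through it form a sequence along which probabilities can be
    summed. *)
Let scale (n : nat) : nat := Num.truncn (Num.sqrt (ln (n%:R : R))).

Let scale_near K : \forall n \near \oo,
  [/\ (0 < n)%N, (K <= scale n)%N &
      ((scale n)%:R : R) ^+ 2 <= ln (n%:R : R) <= (scale n).+1%:R ^+ 2].
Proof.
exists (Num.truncn (expR (K%:R ^+ 2 : R))).+1 => // n /= Kn.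
have en : expR (K%:R ^+ 2) <= n%:R :> R.
  by apply: ltW; apply: lt_le_trans (truncnS_gt _) _; rewrite ler_nat.
have n0 : 0 < n%:R :> R by apply: lt_le_trans en; exact: expR_gt0.
have Kl : K%:R ^+ 2 <= ln (n%:R : R) by rewrite -ler_expR lnK ?posrE.
have l0 : 0 <= ln (n%:R : R) by apply: le_trans Kl; exact: sqr_ge0.
split; first by rewrite -(ltr0n R).
  rewrite truncn_ge_nat ?sqrtr_ge0 // -(@ger0_norm R K%:R) // -sqrtr_sqr.
  by rewrite ler_wsqrtr.
rewrite -(sqr_sqrtr l0); apply/andP; split.
  by rewrite lerXn2r ?nnegrE ?sqrtr_ge0 // truncn_le ?sqrtr_ge0.
by rewrite lerXn2r ?nnegrE ?sqrtr_ge0 // ltW // truncnS_gt.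
Qed.

Variable T : nat -> rtree.
Hypothesis size_T : forall n, size (T n) = n.

Let close (z : nat -> R[i]) := forall e, 0 < e ->
  \forall j \near \oo, forall n, gf_error (z j) (T n) < e.

(* The shift [j.+2] keeps the parameters near 1; the scale [k] is reached at
   [j = k.-2]. *)
Hypothesis close_expi : forall q : rat, close (fun j => expi (ratr q / j.+2%:R)).
Let zp (m : nat) : R[i] := (expR (m%:R^-1))%:C%C.
Let zn (m : nat) : R[i] := (expR (- m%:R^-1))%:C%C.
Hypothesis close_exp : close (fun j => zp j.+2).
Hypothesis close_expN : close (fun j => zn j.+2).

Let close_scale z e : close z -> 0 < e ->
  \forall n \near \oo, gf_error (z (scale n).-2) (T n) < e.
Proof.
move=> cz e0; have [J _ hJ] := cz e e0.
apply: filterS (scale_near J.+2) => n [_ kJ _]; apply: hJ => /=.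
by move: kJ; case: (scale n) => [|[|m]].
Qed.

Let scale_predK n : (2 <= scale n)%N -> (scale n).-2.+2 = scale n.
Proof. by case: (scale n) => [|[|m]]. Qed.

Let xs n : seq R :=
  [seq (Num.sqrt (ln n%:R))^-1 * (e%:R - ln n%:R) | e <- depths (T n)].

Let cos_cvg (q : rat) (a : R) :
  n%:R^-1 * \sum_(y <- xs n) cos (ratr q * y + a) @[n --> \oo] -->
  cos a * expR (- ((ratr q : R) ^+ 2 / 2)).
Proof.
set th : R := ratr q; set g := expR _.
pose C : R := 1 + (1 + 8 * expR 11) * `|th| + 6 * `|th| ^+ 2 + 10 * `|th| ^+ 3.
have C0 : 0 < C.
  have a0 := normr_ge0 th; have p := expR_ge0 (11 : R).
  have a2 : 0 <= `|th| ^+ 2 by rewrite exprn_ge0.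
  have a3 : 0 <= `|th| ^+ 3 by rewrite exprn_ge0.
  have pa : 0 <= expR 11 * `|th| by rewrite mulr_ge0.
  rewrite /C; move: (expR 11) `|th| p a0 a2 a3 pa => E b p a0 a2 a3 pa; lra.
apply/cvgrPdist_le => eps eps0.
have e4 : 0 < (eps / 4) ^+ 2 by rewrite exprn_gt0 // divr_gt0.
have near1 := close_scale close_exp (@ltr01 R).
have near2 := close_scale close_expN (@ltr01 R).
have near3 := close_scale (close_expi q) e4.
have [A hA] : exists A : nat, 2 * `|th| < A%:R by eexists; exact: truncnS_gt.
have [B hB] : exists B : nat, 2 * C / eps < B%:R by eexists; exact: truncnS_gt.
move: (scale_near (2 + A + B)); apply: filter_app.
move: near1; apply: filter_app; move: near2; apply: filter_app.
move: near3; apply: filterS => n close_q close_n close_p [n0 k_ge k_ln].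
set k := scale n in k_ge k_ln.
have k2 : (2 <= k)%N by lia.
have kk := scale_predK k2; rewrite -/k in kk.
have k0 : 0 < k%:R :> R by rewrite ltr0n; lia.
have thk : 2 * `|th| <= k%:R.
  by apply: ltW; apply: lt_le_trans hA _; rewrite ler_nat; lia.
have Ck : C / k%:R <= eps / 2.
  have : 2 * C / eps <= k%:R.
    by apply: ltW; apply: lt_le_trans hB _; rewrite ler_nat; lia.
  by clear close_p close_n close_q; rewrite !ler_pdivrMr //; lra.
have toK (z : nat -> R[i]) (c : R) :
    gf_error (z (scale n).-2.+2) (T n) < c -> gf_error (z k) (T n) <= c.
  by rewrite -/k kk => /ltW.
have err1 : gf_error (zp k) (T n) <= 1.
  by apply: (toK zp); exact: close_p.
have err2 : gf_error (zn k) (T n) <= 1.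
  by apply: (toK zn); exact: close_n.
have err3 : normc (gf_mart (expi (th / k%:R)) (T n) - 1) <= eps / 4.
  have h : gf_error (expi (th / k%:R)) (T n) <= (eps / 4) ^+ 2.
    by apply: (toK (fun m => expi (th / m%:R))); exact: close_q.
  by rewrite -ler_sqr ?nnegrE ?normc_ge0 ?divr_ge0 ?(ltW eps0) // normc_sqr.
have := charfun_sqrt (size_T n) n0 k2 k_ln thk err1 err2.
rewrite -/C -/g; set S := _ * \sum_(e <- _) _ => near.
have -> : n%:R^-1 * \sum_(y <- xs n) cos (th * y + a) = complex.Re (S * expi a).
  have nV : n%:R^-1 = (n%:R^-1 : R)%:C%C by rewrite fmorphV rmorph_nat.
  have ReZ (r : R) (w : R[i]) : complex.Re (r%:C%C * w) = r * complex.Re w.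
    by case: w => b c /=; rewrite mul0r subr0.
  rewrite /S nV -mulrA ReZ mulr_suml Re_sum big_map; congr (_ * _).
  by apply: eq_bigr => e _; rewrite -expiD.
have -> : cos a * g = complex.Re (g%:C%C * expi a) by rewrite /= mul0r subr0 mulrC.
have -> : complex.Re (g%:C%C * expi a) - complex.Re (S * expi a) =
    complex.Re ((g%:C%C - S) * expi a).
  by rewrite mulrBl; case: (S * _) (g%:C%C * _) => [b c] [b' c'].
apply: (le_trans (normc_Re _)); rewrite normc_mul normc_expi mulr1.
rewrite -normc_opp opprB (le_trans near) //.
apply: (@le_trans _ _ (2 * (eps / 4) + eps / 2)).
  by rewrite lerD // ler_wpM2l.
by rewrite le_eqVlt; apply/orP; left; apply/eqP; field.
Qed.

(** No probability is left here: any sequence of trees whose generating functions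
    stay close to their means along these parameters has a Gaussian profile. *)
Lemma profile_cvg_normal (f : R -> R) : continuous f -> bounded_fun f ->
  n%:R^-1 * (\sum_(e <- depths (T n))
    f ((Num.sqrt (ln n%:R))^-1 * (e%:R - ln n%:R))) @[n --> \oo] -->
  normal_mean f.
Proof.
move=> cf bf.
have c0 n : 0 <= n%:R^-1 :> R by rewrite invr_ge0.
have := @weak_cvg_normal R (fun n => n%:R^-1) xs c0 cos_cvg (8 * expR 11) _ f cf bf.
have -> : (fun n => n%:R^-1 * (\sum_(e <- depths (T n))
    f ((Num.sqrt (ln n%:R))^-1 * (e%:R - ln n%:R)))) =
    (fun n => n%:R^-1 * (\sum_(y <- xs n) f y)).
  by apply/funext => n; rewrite big_map.
have near1 := close_scale close_exp (@ltr01 R).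
have near2 := close_scale close_expN (@ltr01 R).
apply; move: (scale_near 2); apply: filter_app.
move: near1; apply: filter_app; move: near2.
apply: filterS => n close_n close_p [n0 k_ge k_ln].
rewrite big_map.
have kk := scale_predK k_ge.
have toK (z : nat -> R[i]) (c : R) :
    gf_error (z (scale n).-2.+2) (T n) < c -> gf_error (z (scale n)) (T n) <= c.
  by rewrite kk => /ltW.
apply: (abs_moment_sqrt (size_T n) n0 k_ge k_ln).
  by apply: (toK zp); exact: close_p.
by apply: (toK zn); exact: close_n.
Qed.

End normalised_profile.

Lemma sqnorm_expi_sub1 (R : realType) (q : R) (j : nat) :
  sqnorm (expi (q / j.+2%:R) - 1) <= q ^+ 2 / j.+1%:R ^+ 2.
Proof.
have := normc_expi_sub (q / j.+2%:R) 0; rewrite subr0 expi0 -normc_sqr => h.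
apply: (@le_trans _ _ (`|q / j.+2%:R| ^+ 2)).
  by rewrite lerXn2r ?nnegrE ?normc_ge0.
rewrite real_normK ?num_real // exprMn exprVn ler_wpM2l ?sqr_ge0 //.
by rewrite lef_pV2 ?posrE ?exprn_gt0 // lerXn2r ?nnegrE // ler_nat.
Qed.

Lemma sqnorm_expR_sub1 (R : realType) (v : R) (j : nat) : `|v| = j.+2%:R^-1 ->
  sqnorm ((expR v)%:C%C - 1) <= 4 / j.+1%:R ^+ 2.
Proof.
move=> vj; apply: (@le_trans _ _ (4 * `|v| ^+ 2)); last first.
  rewrite vj exprVn ler_wpM2l // lef_pV2 ?posrE ?exprn_gt0 //.
  by rewrite lerXn2r ?nnegrE // ler_nat.
have v2 : `|v| <= 1 / 2.
  by rewrite vj -[1 / 2]/(1 * 2^-1) mul1r lef_pV2 ?posrE // ler_nat.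
have v1 : v <= 1 / 2 by apply: le_trans v2; exact: ler_norm.
have h1 := expR_quadratic v1; have h2 := expR_ge1Dx v.
have -> : sqnorm ((expR v)%:C%C - 1) = (expR v - 1) ^+ 2.
  by rewrite /sqnorm /= subr0 expr0n addr0.
have h3 : `|expR v - 1| <= 2 * `|v|.
  have a1 := ler_norm v; have a2 := lerNnormlW (lexx `|v|).
  have a3 : v ^+ 2 = `|v| ^+ 2 by rewrite real_normK ?num_real.
  have a0 := normr_ge0 v.
  have a4 : `|v| ^+ 2 <= `|v| / 2 by rewrite expr2 ler_wpM2l //; lra.
  rewrite a3 in h1; move: `|v| a0 a1 a2 a4 h1 h2 => b a0 a1 a2 a4 h1 h2.
  by rewrite ler_norml; apply/andP; split; lra.
rewrite -[leLHS](@real_normK _ (expR v - 1)) ?num_real //.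
apply: (@le_trans _ _ ((2 * `|v|) ^+ 2)); first by rewrite lerXn2r ?nnegrE.
by rewrite exprMn; lra.
Qed.

Theorem corollary7 (R : realType) (d : measure_display)
    (Omega : measurableType d) (P : probability Omega R)
    (RRT : nat -> Omega -> rtree) :
  random_recursive_trees P RRT ->
  {ae P, forall w,
    weak_cvg (fun n => theta (Num.sqrt (ln n%:R)) (ln n%:R) (prof R n (RRT n w)))
             (normal_prob 0 1)}.
Proof.
move=> chain.
have size_as := size_tree_as chain.
have inv_norm j : `|j.+2%:R^-1 : R| = j.+2%:R^-1 by rewrite ger0_norm ?invr_ge0.
have exp_as := gf_error_as chain
  (fun j => sqnorm_expR_sub1 (inv_norm j)).
have expN_as := gf_error_as chain
  (fun j => sqnorm_expR_sub1 (etrans (normrN _) (inv_norm j))).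
have expi_as : {ae P, forall w, forall (q : rat) (e : R), 0 < e ->
    \forall j \near \oo, forall n,
      gf_error (expi (ratr q / j.+2%:R)) (RRT n w) < e}.
  (* The exceptional sets of the rational frequencies are countably many. *)
  have one m := gf_error_as chain
    (sqnorm_expi_sub1 (odflt 0 (omap ratr (unpickle m : option rat)))).
  have all_q := ae_foralln one.
  apply: filterS all_q => w h q.
  by have := h (pickle q); rewrite pickleK.
have filter_ae : Filter (almost_everywhere P) by exact: ae_filter_ringOfSetsType.
have both := @filterI _ _ filter_ae.
have all_as := both _ _ expi_as (both _ _ expN_as (both _ _ exp_as size_as)).
apply: (@filterS _ _ filter_ae _ _ _ all_as) => w [h1 [h2 [h3 h4]]] f cf bf.
have mf : measurable_fun setT f by exact: continuous_measurable_fun.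
rewrite integral_normal_prob //.
under eq_fun do rewrite (integral_theta_prof _ _ _ _ mf).
have lim := @profile_cvg_normal R (RRT ^~ w) h4 h1 h3 h2 f cf bf.
by apply: cvg_EFin; first exact: nearW.
Qed.
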